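(* Let $A$ and $B$ be C$^*$-algebras and let $\Phi,\Psi:A\to B$ be linear maps such that $(\Phi,\Psi)$ is Jordan-triple multiplicative. Then the following are equivalent: (a) $\Phi$ and $\Psi$ are contractive; (b) $\Psi(a)=\Phi(a^* )^*$ for every $a\in A$; (c) $\Phi$ and $\Psi$ are triple homomorphisms.
   Context: The pair $(\Phi,\Psi)$ of linear maps $A\to B$ is Jordan-triple multiplicative if $\Phi(aba)=\Phi(a)\Psi(b)\Phi(a)$ and $\Psi(aba)=\Psi(a)\Phi(b)\Psi(a)$ for all $a,b\in A$. C$^*$-algebras carry the triple product $\{a,b,c\}=\frac12(ab^*c+cb^*a)$. A triple homomorphism is a linear map $T$ with $T\{a,b,c\}=\{T(a),T(b),T(c)\}$ for all $a,b,c$. Contractive means $\|T(a)\|\le\|a\|$ for all $a$. C$^*$-algebras are not assumed unital, and no continuity of $\Phi,\Psi$ is assumed. *)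

(* Defs.v *)
From HB Require Import structures.
From mathcomp Require Import all_boot all_order all_algebra.
From mathcomp Require Import all_classical all_reals all_analysis.
From mathcomp Require Import complex.
Import Order.TTheory GRing.Theory Num.Theory.
Import numFieldNormedType.Exports.

Set Implicit Arguments.
Unset Strict Implicit.
Unset Printing Implicit Defensive.

Local Open Scope ring_scope.

Declare Scope cstar_scope.
Delimit Scope cstar_scope with cstar.
Local Open Scope cstar_scope.

(* MathComp rings all have a unit, so the product of a possibly non-unital
   C*-algebra is introduced here. As in every normed module over R[i], the
   norm takes its values in R[i] (in fact among the nonnegative reals). The
   scalar conjugate k^* is that of R[i]. *)
HB.mixin Record isCStarAlgebra (R : realType) A
    of CompleteNormedModule R[i] A := {
  amul : A -> A -> A;
  amulA : associative amul;
  amulDl : left_distributive amul +%R;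
  amulDr : right_distributive amul +%R;
  ascaleAl : forall (k : R[i]) (a b : A), k *: amul a b = amul (k *: a) b;
  ascaleAr : forall (k : R[i]) (a b : A), k *: amul a b = amul a (k *: b);
  star : A -> A;
  starK : involutive star;
  starD : {morph star : a b / a + b};
  starZ : forall (k : R[i]) (a : A), star (k *: a) = k^* *: star a;
  starM : forall a b : A, star (amul a b) = amul (star b) (star a);
  ler_norm_amul : forall a b : A, `|amul a b| <= `|a| * `|b|;
  norm_star_amul : forall a : A, `|amul (star a) a| = `|a| ^+ 2
}.

#[short(type="cstarAlgType")]
HB.structure Definition CStarAlgebra (R : realType) :=
  {A of CompleteNormedModule R[i] A & isCStarAlgebra R A}.

Notation "a ** b" := (amul a b) (at level 40, left associativity) : cstar_scope.

Definition triple_product (R : realType) (A : cstarAlgType R) (a b c : A) : A :=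
  2^-1 *: (a ** star b ** c + c ** star b ** a).

Definition jordan_triple_multiplicative (R : realType) (A B : cstarAlgType R)
    (Phi Psi : A -> B) : Prop :=
  (forall a b : A, Phi (a ** b ** a) = Phi a ** Psi b ** Phi a) /\
  (forall a b : A, Psi (a ** b ** a) = Psi a ** Phi b ** Psi a).

Definition triple_homomorphism (R : realType) (A B : cstarAlgType R)
    (T : {linear A -> B}) : Prop :=
  forall a b c : A,
    T (triple_product a b c) = triple_product (T a) (T b) (T c).

Definition contractive (R : realType) (A B : cstarAlgType R)
    (T : A -> B) : Prop :=
  forall a : A, `|T a| <= `|a|.

(* Main.v *)
(* In the direction from (c) to (a), a norm-increasing triple homomorphism [T]
   is rescaled so that [|T a| = 1 > |a|]. The solution [f] of [f = a + Q^4 f],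
   [Q u = a u^* a], is mapped to an element that would make the powers of the
   hermitian element [h = (T a) (T a)^*] of norm [1] summable.
   In the direction from (a) to (b), let [a] be hermitian. Odd polynomials [f]
   in [a] satisfy [Phi (f g k) = Phi f Psi g Phi k]. If [f] is close to
   unimodular, then [Phi f] and [Psi f^*] are contractions with
   [Phi f Psi f^* Phi a ~ Phi a], which as in a Hilbert space forces
   [Psi f^* Phi a ~ (Phi f)^* Phi a]. Since [a] is a linear combination of such
   [f], [(Psi a - star (Phi a)) Phi a = 0]; combined with the same identity for
   [(Psi, Phi)] this makes [d = Psi a - star (Phi a)] satisfy [d d^* d = 0].
   The required positivity of the elements [a^* a] is obtained without spectral
   theory: square roots are approximated by polynomials, and the norms of
   commuting hermitian elements are compared by means of
   [|p w|^2 <= |w^* (p^2 + q^2) w|]. *)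

Require Import Defs.
From HB Require Import structures.
From mathcomp Require Import all_boot all_order all_algebra.
From mathcomp Require Import all_classical all_reals all_analysis.
From mathcomp Require Import complex.
From mathcomp Require Import ring lra.
Import Order.TTheory GRing.Theory Num.Theory.
Import numFieldNormedType.Exports.

Set Implicit Arguments.
Unset Strict Implicit.
Unset Printing Implicit Defensive.

Local Open Scope ring_scope.
Local Open Scope cstar_scope.


(** * Linear identities in modules *)

(* The square-zero extension [K + V] is a commutative ring, so that [ring]
   decides linear identities in the module [V]. *)
Definition sqz (K : comNzRingType) (V : lmodType K) : Type := (K * V)%type.

Section SquareZero.
Variables (K : comNzRingType) (V : lmodType K).

HB.instance Definition _ := GRing.Zmodule.on (sqz V).

Definition sqz_mul (x y : sqz V) : sqz V := (x.1 * y.1, x.1 *: y.2 + y.1 *: x.2).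

Let sqz_mulA : associative sqz_mul.
Proof.
move=> [a u] [b v] [c w]; congr pair => /=; first exact: mulrA.
rewrite !scalerDr !scalerA addrA; congr (_ + _ *: _ + _ *: _); exact: mulrC.
Qed.

Let sqz_mulC : commutative sqz_mul.
Proof. by move=> [a u] [b v]; congr pair => /=; rewrite ?[_ * b]mulrC 1?addrC. Qed.

Let sqz_mul1 : left_id (1, 0) sqz_mul.
Proof. by move=> [a u]; congr pair; rewrite /= ?mul1r// scale1r scaler0 addr0. Qed.

Let sqz_mulDl : left_distributive sqz_mul +%R.
Proof.
move=> [a u] [b v] [c w]; congr pair; rewrite /= ?mulrDl//.
by rewrite scalerDl scalerDr addrACA.
Qed.

Let sqz_10 : (1, 0) != 0 :> sqz V.
Proof. by rewrite xpair_eqE oner_eq0. Qed.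

HB.instance Definition _ := GRing.Zmodule_isComNzRing.Build (sqz V)
  sqz_mulA sqz_mulC sqz_mul1 sqz_mulDl sqz_10.

Definition sqz_vec (v : V) : sqz V := (0, v).
Definition sqz_scal (k : K) : sqz V := (k, 0).

Let sqz_vec_additive : zmod_morphism sqz_vec.
Proof. by move=> u v; congr pair; rewrite /= subr0. Qed.
HB.instance Definition _ := GRing.isZmodMorphism.Build V (sqz V) sqz_vec sqz_vec_additive.

Let sqz_scal_additive : zmod_morphism sqz_scal.
Proof. by move=> u v; congr pair; rewrite /= subr0. Qed.
Let sqz_scal_mult : monoid_morphism sqz_scal.
Proof. by split=> // u v; congr pair; rewrite /= !scaler0 addr0. Qed.
HB.instance Definition _ := GRing.isZmodMorphism.Build K (sqz V) sqz_scal sqz_scal_additive.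
HB.instance Definition _ := GRing.isMonoidMorphism.Build K (sqz V) sqz_scal sqz_scal_mult.

Lemma sqz_vecZ k v : sqz_vec (k *: v) = sqz_scal k * sqz_vec v.
Proof. by congr pair; rewrite /= ?mulr0 // scale0r addr0. Qed.

Lemma sqz_vec0 : sqz_vec 0 = 0. Proof. by []. Qed.

Lemma sqz_vecD u v : sqz_vec (u + v) = sqz_vec u + sqz_vec v.
Proof. exact: raddfD. Qed.

Lemma sqz_vecN u : sqz_vec (- u) = - sqz_vec u.
Proof. exact: raddfN. Qed.

Lemma sqz_vec_inj : injective sqz_vec.
Proof. by move=> u v []. Qed.

End SquareZero.

Ltac module :=
  apply: sqz_vec_inj; rewrite ?(sqz_vecD, sqz_vecN, sqz_vec0, sqz_vecZ); ring.


(** * The real-valued norm and the basic rules for product and star *)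

Section RealNorm.
Variables (R : realType) (B : cstarAlgType R).
Implicit Types (u v w : B) (r s : R).

(** The norm in [R[i]] is a nonnegative real, so its real part is the same number; over [R] the
    tactics [lra] and [nra] apply. *)
Definition nrm w : R := complex.Re `|w|.

Lemma nrmE w : `|w| = (nrm w)%:C%C.
Proof. by rewrite /nrm RRe_real // ger0_real. Qed.

Lemma nrm_ge0 w : 0 <= nrm w.
Proof. by rewrite -lecR -nrmE normr_ge0. Qed.

Lemma nrm0 : nrm 0 = 0.
Proof. by rewrite /nrm normr0. Qed.

Lemma nrm_eq0 w : nrm w = 0 -> w = 0.
Proof. by move=> h; apply/normr0_eq0; rewrite nrmE h. Qed.

Lemma nrmN w : nrm (- w) = nrm w.
Proof. by rewrite /nrm normrN. Qed.

Lemma nrmD u v : nrm (u + v) <= nrm u + nrm v.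
Proof. by rewrite -lecR rmorphD /= -!nrmE ler_normD. Qed.

Lemma nrmB u v : nrm (u - v) <= nrm u + nrm v.
Proof. by rewrite -[nrm v]nrmN nrmD. Qed.

Lemma nrmC u v : nrm (u - v) = nrm (v - u).
Proof. by rewrite -nrmN opprB. Qed.

Lemma nrm_leB u v : nrm u <= nrm v + nrm (u - v).
Proof. by rewrite -{1}[u](subrKC v) nrmD. Qed.

Lemma nrmZ (k : R[i]) w : nrm (k *: w) = complex.Re `|k| * nrm w.
Proof.
apply: complexI; rewrite rmorphM /= -!nrmE normrZ; congr (_ * _).
Qed.

Lemma nrmZr r w : 0 <= r -> nrm (r%:C%C *: w) = r * nrm w.
Proof. by move=> r0; rewrite nrmZ ger0_norm // ler0c. Qed.

Lemma nrmM u v : nrm (u ** v) <= nrm u * nrm v.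
Proof. by rewrite -lecR rmorphM /= -!nrmE ler_norm_amul. Qed.

Lemma nrm_star_amul w : nrm (star w ** w) = nrm w ^+ 2.
Proof. by apply: complexI; rewrite rmorphXn /= -!nrmE norm_star_amul. Qed.

Lemma le_nrm_star w : nrm w <= nrm (star w).
Proof.
have [->|w0] := eqVneq (nrm w) 0; first exact: nrm_ge0.
have {}w0 : 0 < nrm w by rewrite lt_neqAle eq_sym w0 nrm_ge0.
by rewrite -(ler_pM2r w0) -expr2 -nrm_star_amul nrmM.
Qed.

Lemma nrm_star w : nrm (star w) = nrm w.
Proof. by apply/eqP; rewrite eq_le le_nrm_star -{2}[w]starK le_nrm_star. Qed.

Lemma nrm_amul_star w : nrm (w ** star w) = nrm w ^+ 2.
Proof. by rewrite -{1}[w]starK nrm_star_amul nrm_star. Qed.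

Lemma nrm_sqr w : star w = w -> nrm (w ** w) = nrm w ^+ 2.
Proof. by move=> hw; rewrite -{1}hw nrm_star_amul. Qed.

Lemma amul0l w : 0 ** w = 0.
Proof. by apply: (addrI (0 ** w)); rewrite -amulDl !addr0. Qed.

Lemma amul0r w : w ** 0 = 0.
Proof. by apply: (addrI (w ** 0)); rewrite -amulDr !addr0. Qed.

Lemma amulNl u v : - u ** v = - (u ** v).
Proof. by apply: (addrI (u ** v)); rewrite -amulDl !subrr amul0l. Qed.

Lemma amulNr u v : u ** - v = - (u ** v).
Proof. by apply: (addrI (u ** v)); rewrite -amulDr !subrr amul0r. Qed.

Lemma star0 : star 0 = 0 :> B.
Proof. by apply: (addrI (star 0)); rewrite -starD !addr0. Qed.

Lemma starN w : star (- w) = - star w.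
Proof. by apply: (addrI (star w)); rewrite -starD !subrr star0. Qed.

Lemma conj_realC r : ((r%:C%C : R[i])^*)%R = r%:C%C.
Proof. by apply/CrealP/complex_realP; exists r. Qed.

Lemma starZr r w : star (r%:C%C *: w) = r%:C%C *: star w.
Proof. by rewrite starZ conj_realC. Qed.

Lemma starZi w : star ('i *: w) = - 'i *: star w.
Proof. by rewrite starZ conjCi. Qed.

End RealNorm.



(** * Polynomials acting by left multiplication *)

(* As the algebra has no unit, [p h] is only available as an operator. *)
Definition pact (R : realType) (B : cstarAlgType R) (h : B) (p : {poly R}) (w : B) : B :=
  \sum_(i < size p) (p`_i)%:C%C *: iter i (amul h) w.

Section PolyAction.
Variables (R : realType) (B : cstarAlgType R) (h : B).
Implicit Types (u v w : B) (p q : {poly R}).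

Lemma pact_widen n p w : (size p <= n)%N ->
  pact h p w = \sum_(i < n) (p`_i)%:C%C *: iter i (amul h) w.
Proof.
move=> pn; rewrite /pact (big_ord_widen n (fun i => (p`_i)%:C%C *: iter i (amul h) w))//.
rewrite big_mkcond; apply: eq_bigr => i _.
by case: ltnP => // ip; rewrite nth_default // scale0r.
Qed.

Lemma pactD p q w : pact h (p + q) w = pact h p w + pact h q w.
Proof.
pose n := maxn (size (p + q)) (maxn (size p) (size q)).
rewrite !(@pact_widen n) ?leq_max ?leqnn ?orbT // -big_split /=.
by apply: eq_bigr => i _; rewrite coefD rmorphD scalerDl.
Qed.

Lemma pactZ r p w : pact h (r *: p) w = r%:C%C *: pact h p w.
Proof.
pose n := maxn (size (r *: p)) (size p).
rewrite !(@pact_widen n) ?leq_max ?leqnn ?orbT // scaler_sumr.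
by apply: eq_bigr => i _; rewrite coefZ rmorphM scalerA.
Qed.

Lemma pactC c w : pact h c%:P w = c%:C%C *: w.
Proof. by rewrite (@pact_widen 1) ?size_polyC_leq1 // big_ord1 coefC. Qed.

Lemma pactN p w : pact h (- p) w = - pact h p w.
Proof. by rewrite -scaleN1r pactZ rmorphN1 scaleN1r. Qed.

Lemma pactB p q w : pact h (p - q) w = pact h p w - pact h q w.
Proof. by rewrite pactD pactN. Qed.

Lemma pact0 w : pact h 0 w = 0.
Proof. by rewrite -polyC0 pactC scale0r. Qed.

Lemma pact1 w : pact h 1 w = w.
Proof. by rewrite -polyC1 pactC scale1r. Qed.

Lemma pactMX p w : pact h (p * 'X) w = pact h p (h ** w).
Proof.
rewrite (@pact_widen (size p).+1); last first.
  by have [->|/size_mulX ->//] := eqVneq p 0; rewrite mul0r size_poly0.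
rewrite big_ord_recl coefMX /= scale0r add0r; apply: eq_bigr => i _.
by rewrite coefMX /= -iterSr.
Qed.

Lemma pactX w : pact h 'X w = h ** w.
Proof. by rewrite -['X]mul1r pactMX pact1. Qed.

Lemma pact_amul p w z : pact h p w ** z = pact h p (w ** z).
Proof.
elim/poly_ind: p w => [|p c IH] w; first by rewrite !pact0 amul0l.
by rewrite !pactD !pactMX !pactC amulDl IH amulA ascaleAl.
Qed.

Lemma pactDr p u v : pact h p (u + v) = pact h p u + pact h p v.
Proof.
elim/poly_ind: p u v => [|p c IH] u v; first by rewrite !pact0 addr0.
by rewrite !pactD !pactMX !pactC amulDr IH scalerDr addrACA.
Qed.

Lemma pactZrC p (k : R[i]) u : pact h p (k *: u) = k *: pact h p u.
Proof.
elim/poly_ind: p u => [|p c IH] u; first by rewrite !pact0 scaler0.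
by rewrite !pactD !pactMX !pactC -ascaleAr IH scalerDr !scalerA [_ * k]mulrC.
Qed.

Lemma pact_mulX p w : pact h p (h ** w) = h ** pact h p w.
Proof.
elim/poly_ind: p w => [|p c IH] w; first by rewrite !pact0 amul0r.
by rewrite !pactD !pactMX !pactC amulDr IH ascaleAr.
Qed.

Lemma pactM p q w : pact h (p * q) w = pact h p (pact h q w).
Proof.
elim/poly_ind: p w => [|p c IH] w; first by rewrite mul0r !pact0.
rewrite mulrDl pactD -mulrA ['X * q]mulrC mulrA pactMX IH.
by rewrite mul_polyC pactZ pactD pactMX pactC pact_mulX.
Qed.

Lemma pactCM p q w : pact h p (pact h q w) = pact h q (pact h p w).
Proof. by rewrite -!pactM mulrC. Qed.

(** A real polynomial in a hermitian [h] is self-adjoint for the [B]-valued inner product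
    [star u ** v]. *)
Lemma pact_adj p u v : star h = h -> star (pact h p u) ** v = star u ** pact h p v.
Proof.
move=> hh; elim/poly_ind: p u v => [|p c IH] u v.
  by rewrite !pact0 star0 amul0l amul0r.
rewrite !pactD !pactMX !pactC starD amulDl amulDr IH starM hh -amulA.
by rewrite pact_mulX starZr -ascaleAl -ascaleAr.
Qed.

End PolyAction.

(** Linear extension of [x (y x)^n = (x y)^n x]. *)
Lemma pact_intertwine (R : realType) (B : cstarAlgType R) (x y w : B) p :
  x ** pact (y ** x) p w = pact (x ** y) p (x ** w).
Proof.
elim/poly_ind: p w => [|p c IH] w; first by rewrite !pact0 amul0r.
by rewrite !pactD !pactMX !pactC amulDr IH -ascaleAr !amulA.
Qed.

Lemma pact_comp_sqr (R : realType) (B : cstarAlgType R) (h w : B) p :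
  pact h (p \Po 'X^2) w = pact (h ** h) p w.
Proof.
elim/poly_ind: p w => [|p c IH] w; first by rewrite comp_poly0 !pact0.
rewrite comp_polyD comp_polyM comp_polyX comp_polyC !pactD pactMX !pactC pactM IH.
by rewrite expr2 pactMX pactX amulA.
Qed.

Lemma pact_herm (R : realType) (B : cstarAlgType R) (h : B) p :
  star h = h -> star (pact h p h) = pact h p h.
Proof.
move=> hh; elim/poly_ind: p => [|p c IH]; first by rewrite !pact0 star0.
rewrite pactD pactMX pactC starD starZr pact_mulX starM IH hh.
by rewrite pact_amul pact_mulX.
Qed.

Lemma pactXM (R : realType) (B : cstarAlgType R) (h w : B) p :
  pact h p h ** w = pact h (p * 'X) w.
Proof. by rewrite pactMX pact_amul. Qed.

(** * Operator bounds for polynomials in an element *)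

Lemma le_limit (R : realType) (x y c : R) : 0 <= c ->
  (forall e, 0 < e -> e <= 1 -> x <= y + e * c) -> x <= y.
Proof.
move=> c0 H; apply/ler_addgt0Pr => e e0.
have c1 : 0 < c + 1 by rewrite ltr_wpDl.
pose d := Num.min 1 (e / (c + 1)).
have d0 : 0 < d by rewrite lt_min ltr01 divr_gt0.
have d1 : d <= 1 by rewrite ge_min lexx.
rewrite (le_trans (H _ d0 d1)) // lerD2l.
have : d * (c + 1) <= e by rewrite -ler_pdivlMr // ge_min lexx orbT.
by apply: le_trans; rewrite ler_wpM2l ?(ltW d0) // lerDl.
Qed.

(** A bound for the operator norm of left multiplication by [p(h)]; for hermitian [h] it stands in
    for a bound of [|p|] on the spectrum. *)
Definition bnd (R : realType) (B : cstarAlgType R) (h : B) (p : {poly R}) (M : R) :=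
  forall w, nrm (pact h p w) <= M * nrm w.

Section Bnd.
Variables (R : realType) (B : cstarAlgType R) (h : B).
Implicit Types (u v w : B) (p q : {poly R}) (M N : R).

Lemma bndW p M N : M <= N -> bnd h p M -> bnd h p N.
Proof. by move=> MN hp w; rewrite (le_trans (hp w)) // ler_wpM2r ?nrm_ge0. Qed.

Lemma bndD p q M N : bnd h p M -> bnd h q N -> bnd h (p + q) (M + N).
Proof.
by move=> hp hq w; rewrite pactD mulrDl (le_trans (nrmD _ _)) // lerD.
Qed.

Lemma bndN p M : bnd h p M -> bnd h (- p) M.
Proof. by move=> hp w; rewrite pactN nrmN. Qed.

Lemma bndB p q M N : bnd h p M -> bnd h q N -> bnd h (p - q) (M + N).
Proof. by move=> hp /bndN; exact: bndD. Qed.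

Lemma bndM p q M N : 0 <= M -> bnd h p M -> bnd h q N -> bnd h (p * q) (M * N).
Proof.
by move=> M0 hp hq w; rewrite pactM -mulrA (le_trans (hp _)) // ler_wpM2l.
Qed.

Lemma bndC c : bnd h c%:P `|c|.
Proof.
by move=> w; rewrite pactC nrmZ normc_def /= expr0n addr0 sqrtr_sqr.
Qed.

Lemma bnd1 : bnd h 1 1.
Proof. by move=> w; rewrite pact1 mul1r. Qed.

Lemma bnd0 : bnd h 0 0.
Proof. by move=> w; rewrite pact0 nrm0 mul0r. Qed.

Lemma bndX M : nrm h <= M -> bnd h 'X M.
Proof.
by move=> hM w; rewrite pactX (le_trans (nrmM _ _)) // ler_wpM2r ?nrm_ge0.
Qed.

Lemma bndZ r p M : bnd h p M -> bnd h (r *: p) (`|r| * M).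
Proof. by move=> hp; rewrite -mul_polyC; apply: bndM => //; apply: bndC. Qed.

Lemma bnd_limit p M : (forall e, 0 < e -> e <= 1 -> bnd h p (M + e)) -> bnd h p M.
Proof.
move=> H w; apply: (@le_limit _ _ _ (nrm w)); first exact: nrm_ge0.
by move=> e e0 e1; rewrite -mulrDl; exact: H.
Qed.

End Bnd.



(** * Commuting hermitian elements and approximate square roots *)

Section TwoSquares.
Variables (R : realType) (B : cstarAlgType R) (h : B).
Hypothesis hh : star h = h.
Implicit Types (w : B) (p q Y k : {poly R}) (M N e : R).

(* The normal elements [v = p w + i q w] and [v' = p w - i q w] both have
   square norm [nrm (star w ** (p^2 + q^2) w)], and [p w] is their mean. *)
Lemma two_squares p q w :
  nrm (pact h p w) ^+ 2 <= nrm (star w ** pact h (p ^+ 2 + q ^+ 2) w).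
Proof.
set N := nrm (star w ** _).
have H (k : R[i]) : k ^+ 2 = -1 -> (k^*)%R = - k ->
    nrm (pact h p w + k *: pact h q w) ^+ 2 = N.
  move=> k2 kc; rewrite -nrm_star_amul; congr nrm.
  rewrite starD starZ kc amulDl !amulDr -!ascaleAl -!ascaleAr !pact_adj //.
  rewrite scalerA mulNr -expr2 k2 opprK scale1r -!pactM [q * p]mulrC.
  rewrite [(p ^+ 2 + _)]/(_ + _) pactD amulDr !expr2; module.
have h1 := H 'i (sqrCi _) (conjCi _).
have h2 : nrm (pact h p w + - 'i *: pact h q w) ^+ 2 = N.
  by apply: H; rewrite ?sqrrN ?sqrCi // rmorphN /= conjCi.
have h3 : nrm (pact h p w + 'i *: pact h q w) = nrm (pact h p w + - 'i *: pact h q w).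
  by apply/eqP; rewrite -(@eqrXn2 _ 2) ?nrm_ge0 // h1 h2.
rewrite -h1 lerXn2r ?nnegrE ?nrm_ge0 //.
have e : 2%:C%C *: pact h p w =
    (pact h p w + 'i *: pact h q w) + (pact h p w + - 'i *: pact h q w).
  by rewrite rmorph_nat; module.
by have := nrmD (pact h p w + 'i *: pact h q w) (pact h p w + - 'i *: pact h q w);
  rewrite -e nrmZr // -h3 -mulr2n -[X in _ <= X]mulr_natl ler_pM2l.
Qed.

Lemma two_squares_bnd p q M w : bnd h (p ^+ 2 + q ^+ 2) M ->
  nrm (pact h p w) ^+ 2 <= M * nrm w ^+ 2.
Proof.
move=> H; rewrite (le_trans (two_squares p q w)) // (le_trans (nrmM _ _)) //.
by rewrite nrm_star expr2 mulrCA ler_wpM2l ?nrm_ge0.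
Qed.

Lemma bnd_two_squares p q M : 0 <= M -> bnd h (p ^+ 2 + q ^+ 2) (M ^+ 2) -> bnd h p M.
Proof.
move=> M0 H w; rewrite -[_ <= _](@ler_pXn2r _ 2) ?nnegrE ?mulr_ge0 ?nrm_ge0 //.
by rewrite exprMn; exact: two_squares_bnd H.
Qed.

End TwoSquares.

(* The iteration [v := (k + v^2) / 2] converges to [1 - sqrt (1 - k)]; its
   values are polynomials in [k], and for [k] of norm at most [1] their norms
   are controlled by the scalar iteration started with [k = 1]. *)
Fixpoint sqrt_iter (R : realType) (n : nat) : {poly R} :=
  if n is m.+1 then 2^-1 *: ('X + sqrt_iter R m ^+ 2) else 0.

Fixpoint sqrt_iter1 (R : realType) (n : nat) : R :=
  if n is m.+1 then (1 + sqrt_iter1 R m ^+ 2) / 2 else 0.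

(** The defect [u = 1 - t] evolves to [u - u^2 / 2], so [1 / u] starts at [1] and grows by at least
    [1 / 2] per step. *)
Lemma sqrt_iter1_bounds (R : realType) n :
  0 <= sqrt_iter1 R n <= 1 /\ 1 - sqrt_iter1 R n <= 2 / n.+2%:R.
Proof.
elim: n => [|n [/andP[t0 t1] tn]] /=; first by rewrite subr0 divff // lexx ler01.
have n2 : 0 < n.+2%:R :> R by rewrite ltr0n.
have n3 : 0 < n.+3%:R :> R by rewrite ltr0n.
set t := sqrt_iter1 R n in t0 t1 tn *.
split; first by nra.
rewrite ler_pdivlMr //.
have -> : n.+3%:R = n.+2%:R + 1 :> R by rewrite -natr1.
move: tn; rewrite ler_pdivlMr //.
move: n2; set N : R := n.+2%:R => n2 tn.
have N2 : 2 <= N by rewrite ler_nat.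
nra.
Qed.

Section SqrtIter.
Variables (R : realType) (B : cstarAlgType R) (h : B) (k : {poly R}).
Hypothesis hk : bnd h k 1.

Lemma bnd_sqrt_iter n : bnd h (sqrt_iter R n \Po k) (sqrt_iter1 R n).
Proof.
elim: n => [|n IH]; first by rewrite /= comp_poly0; exact: bnd0.
rewrite [sqrt_iter R n.+1]/= comp_polyZ comp_polyD comp_polyX rmorphXn /=.
have := bndZ 2^-1 (bndD hk (bndM (proj1 (andP (proj1 (sqrt_iter1_bounds R n)))) IH IH)).
by rewrite ger0_norm ?invr_ge0 // -!expr2 [X in bnd _ _ X]mulrC.
Qed.

(** Successive differences satisfy [v'' - v' = (v' + v) (v' - v) / 2], and the scalar iteration
    obeys the same recursion, so the bounds propagate. *)
Lemma bnd_sqrt_iter_step n :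
  bnd h ((sqrt_iter R n.+1 \Po k) - (sqrt_iter R n \Po k))
    (sqrt_iter1 R n.+1 - sqrt_iter1 R n).
Proof.
elim: n => [|n IH].
  by rewrite [sqrt_iter R 0]/= comp_poly0 !subr0; exact: bnd_sqrt_iter.
have [/andP[t0 _] _] := sqrt_iter1_bounds R n.
have [/andP[t1 _] _] := sqrt_iter1_bounds R n.+1.
have := bndZ 2^-1 (bndM (addr_ge0 t1 t0) (bndD (bnd_sqrt_iter n.+1) (bnd_sqrt_iter n)) IH).
rewrite ger0_norm ?invr_ge0 // => H.
suff [-> ->] : (sqrt_iter R n.+2 \Po k) - (sqrt_iter R n.+1 \Po k) =
   2^-1 *: (((sqrt_iter R n.+1 \Po k) + (sqrt_iter R n \Po k)) *
     ((sqrt_iter R n.+1 \Po k) - (sqrt_iter R n \Po k))) /\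
   sqrt_iter1 R n.+2 - sqrt_iter1 R n.+1 = 2^-1 * ((sqrt_iter1 R n.+1 + sqrt_iter1 R n) *
     (sqrt_iter1 R n.+1 - sqrt_iter1 R n)) by [].
split; last by rewrite /=; field.
have E m : sqrt_iter R m.+1 \Po k = 2^-1 *: (k + (sqrt_iter R m \Po k) ^+ 2).
  by rewrite [sqrt_iter R m.+1]/= comp_polyZ comp_polyD comp_polyX rmorphXn.
rewrite (E n.+1) {2}(E n) -scalerBr; congr (_ *: _); ring.
Qed.

End SqrtIter.

(** For an iterate [v] with successor [v'], the error [(1 - v)^2 - (1 - k)] is exactly [2 (v' - v)],
    which is bounded by the scalar value [(1 - t)^2]. *)
Lemma approx_sqrt (R : realType) (e : R) : 0 < e ->
  exists V : {poly R}, forall (B : cstarAlgType R) (h : B) k, bnd h k 1 ->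
    bnd h (V \Po k) 1 /\ bnd h ((1 - (V \Po k)) ^+ 2 - (1 - k)) e.
Proof.
move=> e0; have [n en] : exists n, 4 / n.+2%:R <= e.
  have hn := archi_boundP (ltW (divr_gt0 (ltr0Sn R 3) e0)).
  exists (Num.bound (4 / e)); rewrite ler_pdivrMr ?ltr0n // mulrC -ler_pdivrMr //.
  by rewrite (le_trans (ltW hn)) // ler_nat ltnW // ltnW.
exists (sqrt_iter R n) => B h k hk.
have [/andP[t0 t1] tn] := sqrt_iter1_bounds R n.
split; first exact: bndW t1 (bnd_sqrt_iter hk n).
have := bndZ 2 (bnd_sqrt_iter_step hk n); set M := _ * _ => H.
have {H} : bnd h ((1 - (sqrt_iter R n \Po k)) ^+ 2 - (1 - k)) M.
  suff <- : 2 *: ((sqrt_iter R n.+1 \Po k) - (sqrt_iter R n \Po k)) =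
     (1 - (sqrt_iter R n \Po k)) ^+ 2 - (1 - k) by [].
  rewrite [sqrt_iter R n.+1]/= comp_polyZ comp_polyD comp_polyX rmorphXn /=.
  rewrite scalerBr scalerA divff // scale1r -[2 *: _]mul_polyC polyC_natr; ring.
apply: bndW; rewrite /M ger0_norm //=.
have n2 : 0 < n.+2%:R :> R by rewrite ltr0n.
have : 1 <= n.+2%:R :> R by rewrite ler1n.
move: tn en n2; rewrite !ler_pdivlMr ?ler_pdivrMr ?ltr0n //.
set t := sqrt_iter1 R n in t0 t1 *; set N : R := n.+2%:R => tn en n2 N1.
have : (1 - t) ^+ 2 * N <= 2 * (1 - t) by nra.
nra.
Qed.



(** * Contractive polynomials in a hermitian element *)

Section Contractions.
Variables (R : realType) (B : cstarAlgType R) (h : B).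
Hypothesis hh : star h = h.
Implicit Types (w : B) (p q Y : {poly R}) (e : R).

Lemma bnd_nat n : bnd h n%:R n%:R.
Proof. by have := @bndC R B h n%:R; rewrite ger0_norm // polyC_natr. Qed.

Lemma bnd_two_squares1 p q e : 0 <= e -> bnd h (p ^+ 2 + q ^+ 2) (1 + e) ->
  bnd h p (1 + e).
Proof.
move=> e0 H; apply: (bnd_two_squares hh (q := q)); first by rewrite addr_ge0.
by apply: bndW H; rewrite expr2 ler_peMr ?lerDl // addr_ge0.
Qed.

(** If [o] approximates the square root of [1 - Y^2], then [o^2 + Y^2 ~ 1] makes [o] almost a
    contraction, hence also [o^2 ~ 1 - Y^2]. *)
Lemma bnd_one_sub_sqr Y : bnd h Y 1 -> bnd h (1 - Y ^+ 2) 1.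
Proof.
move=> hY; apply: bnd_limit => e e0 e1.
have e4 : 0 < e / 4 by rewrite divr_gt0.
have hk : bnd h (Y ^+ 2) 1 by rewrite expr2 -[1]mulr1; exact: bndM.
have [V /(_ _ _ _ hk) [_]] := approx_sqrt e4.
set o := 1 - _; set r := _ - _ => hr.
have ho : bnd h o (1 + e / 4).
  apply: (@bnd_two_squares1 _ Y); first exact: ltW.
  have -> : o ^+ 2 + Y ^+ 2 = 1 + r by rewrite /r; ring.
  by apply: bndD => //; exact: bnd1.
have -> : 1 - Y ^+ 2 = o * o - r by rewrite /r; ring.
have o0 : 0 <= 1 + e / 4 by rewrite addr_ge0 // ltW.
apply: bndW (bndB (bndM o0 ho ho) hr); nra.
Qed.

(** Double angle formulas: with [Y] as sine and [o] as cosine, [1 - 2 Y^2] and [2 Y o] have squares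
    summing to almost [1]. *)
Lemma bnd_one_sub_2sqr Y : bnd h Y 1 -> bnd h (1 - 2 * Y ^+ 2) 1.
Proof.
move=> hY; apply: bnd_limit => e e0 e1.
have e4 : 0 < e / 4 by rewrite divr_gt0.
have hk : bnd h (Y ^+ 2) 1 by rewrite expr2 -[1]mulr1; exact: bndM.
have [V /(_ _ _ _ hk) [_]] := approx_sqrt e4.
set o := 1 - _; set r := _ - _ => hr.
apply: (@bnd_two_squares1 _ (2 * Y * o)); first exact: ltW.
have -> : (1 - 2 * Y ^+ 2) ^+ 2 + (2 * Y * o) ^+ 2 = 1 + 4 * (Y ^+ 2 * r).
  by rewrite /r; ring.
apply: bndD; first exact: bnd1.
by apply: bndW (bndM _ (bnd_nat 4) (bndM _ hk hr)) => //; lra.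
Qed.

Lemma bnd_4sqr_one_sub_sqr Y : bnd h Y 1 -> bnd h (4 * Y ^+ 2 * (1 - Y ^+ 2)) 1.
Proof.
move=> /bnd_one_sub_2sqr/bnd_one_sub_sqr.
by have -> : 1 - (1 - 2 * Y ^+ 2) ^+ 2 = 4 * Y ^+ 2 * (1 - Y ^+ 2) by ring.
Qed.

End Contractions.

(* The norm of [g] is attained on the spectrum of [g], hence the constant [k]
   is in fact nonpositive; the factor [4] comes from [x (1 - x) <= 1 / 4]. *)
Lemma top_spectrum (R : realType) (B : cstarAlgType R) (g : B) (k : R) :
  star g = g -> 0 < nrm g ->
  (forall w, k * nrm w <= nrm ((nrm g ^+ 2)%:C%C *: w - g ** g ** w)) ->
  4 * k <= nrm g ^+ 2.
Proof.
move=> gg; set b := nrm g => b0 H.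
have [k0|k0] := ltP k 0; first by nra.
have b'0 : 0 <= b^-1 by rewrite invr_ge0 ltW.
have bY : bnd g (b^-1 *: 'X) 1.
  have := bndZ b^-1 (bndX (lexx b)); rewrite ger0_norm // mulVf //.
  by rewrite gt_eqF.
have := bndZ (b ^+ 4 / 4) (bnd_4sqr_one_sub_sqr gg bY).
have -> : b ^+ 4 / 4 *: (4 * (b^-1 *: 'X) ^+ 2 * (1 - (b^-1 *: 'X) ^+ 2)) =
    ((b ^+ 2)%:P - 'X^2) * 'X^2.
  rewrite -!mul_polyC [(b ^+ 4 / 4)%:P]polyCM !polyC_exp.
  have e1 : b%:P * (b^-1)%:P = 1 by rewrite -polyCM divff // gt_eqF.
  have e2 : (4%:R : {poly R}) * (4^-1)%:P = 1.
    by rewrite -polyC_natr -polyCM divff.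
  transitivity ((4%:R * (4^-1)%:P) * ((b%:P * (b^-1)%:P) ^+ 2 * 'X^2 *
    (b%:P ^+ 2 - (b%:P * (b^-1)%:P) ^+ 2 * 'X^2))); first by ring.
  by rewrite e1 e2; ring.
rewrite ger0_norm ?divr_ge0 ?exprn_ge0 ?(ltW b0) // mulr1 => /(_ g).
(* The test vector is [w = g^3]: its norm is at least [b^3] because [g^4] has norm [b^4], while
   [(b^2 - g^2) w] has norm at most [b^5 / 4]. *)
set w := pact g 'X^2 g; rewrite pactM -/w pactB pactC expr2 pactM !pactX amulA => H1.
have w1 : b ^+ 3 <= nrm w.
  rewrite -(ler_pM2l b0) -exprS /w expr2 pactM !pactX.
  have -> : b ^+ 4 = nrm ((g ** g) ** (g ** g)).
    by rewrite nrm_sqr ?starM ?gg // nrm_sqr // -/b -exprM.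
  by rewrite -[g ** g ** (g ** g)]amulA nrmM.
have := le_trans (H w) H1; have := ler_wpM2l k0 w1; rewrite -/b.
have b3 : 0 < b ^+ 3 by rewrite exprn_gt0.
move=> h1 h2; rewrite -(ler_pM2r b3).
by have := le_trans h1 h2; rewrite -/b; lra.
Qed.

(** * Positive elements *)

(* For hermitian [a] this says that the spectrum of [a] lies in [[0, 2 M]]. *)
Definition posb (R : realType) (B : cstarAlgType R) (M : R) (a : B) :=
  forall w, nrm (M%:C%C *: w - a ** w) <= M * nrm w.

Section Positive.
Variables (R : realType) (B : cstarAlgType R).
Implicit Types (a b g w : B) (M N e t : R).

Lemma posbD M N a b : posb M a -> posb N b -> posb (M + N) (a + b).
Proof.
move=> ha hb w; rewrite mulrDl (le_trans _ (lerD (ha w) (hb w))) //.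
rewrite (le_trans _ (nrmD _ _)) // le_eqVlt; apply/orP; left; apply/eqP.
by congr nrm; rewrite amulDl rmorphD; module.
Qed.

Lemma posbW M N a : M <= N -> posb M a -> posb N a.
Proof.
move=> MN ha w; have -> : N%:C%C *: w - a ** w =
    (N - M)%:C%C *: w + (M%:C%C *: w - a ** w) by rewrite rmorphB; module.
rewrite (le_trans (nrmD _ _)) // nrmZr ?subr_ge0 //.
by have := ha w; lra.
Qed.

(** Adding [M w - a w], of norm at most [M |w|], to [t w + a w] gives [(t + M) w]. *)
Lemma posb_lower M t a w : posb M a -> 0 <= t -> 0 <= M ->
  t * nrm w <= nrm (t%:C%C *: w + a ** w).
Proof.
move=> ha t0 M0; have := nrmD (t%:C%C *: w + a ** w) (M%:C%C *: w - a ** w).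
have -> : t%:C%C *: w + a ** w + (M%:C%C *: w - a ** w) = (t + M)%:C%C *: w.
  by rewrite rmorphD; module.
by rewrite nrmZr ?addr_ge0 //; have := ha w; lra.
Qed.

Lemma posb_sqr M g : star g = g -> 0 < M -> nrm g <= M -> posb (M ^+ 2) (g ** g).
Proof.
move=> gg M0 gM w.
have M'0 : 0 <= M^-1 by rewrite invr_ge0 ltW.
have bY : bnd g (M^-1 *: 'X) 1.
  have := bndZ M^-1 (bndX gM); rewrite ger0_norm // mulVf //.
  by rewrite gt_eqF.
have := bndZ (M ^+ 2) (bnd_one_sub_sqr gg bY).
rewrite exprZn scalerBr scalerA -exprMn divff ?gt_eqF // expr1n scale1r.
rewrite ger0_norm ?exprn_ge0 ?(ltW M0) // mulr1 => /(_ w).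
by rewrite pactB pactZ pact1 expr2 pactM !pactX amulA.
Qed.

Lemma posb_limit M a :
  (forall e, 0 < e -> e <= 1 -> exists2 b, nrm (a - b) <= e & posb (M + e) b) ->
  posb M a.
Proof.
move=> H w; apply: (@le_limit _ _ _ (3 * nrm w)); first by rewrite mulr_ge0 ?nrm_ge0.
move=> e e0 e1; have [b ab hb] := H e e0 e1.
have -> : M%:C%C *: w - a ** w =
    ((M + e)%:C%C *: w - b ** w) - ((a - b) ** w + e%:C%C *: w).
  by rewrite rmorphD amulDl amulNl; module.
rewrite (le_trans (nrmB _ _)) //.
have := hb w; have := nrmD ((a - b) ** w) (e%:C%C *: w).
have := nrmM (a - b) w; rewrite nrmZr ?(ltW e0) //.
have := ler_wpM2r (nrm_ge0 w) ab; lra.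
Qed.

(* If [b^* b = - g^2], then [b b^*] is the sum of the squares [2 Re b ^ 2],
   [2 Im b ^ 2] and [g^2], so its spectrum is nonnegative, whereas that of
   [b^* b] is nonpositive; the two spectra agree away from [0]. *)
Lemma neg_sqr_bound b g e : star g = g -> nrm (star b ** b + g ** g) <= e ->
  nrm g ^+ 2 <= 6 * e.
Proof.
move=> gg; set E := star b ** b + _ => hE; set t := nrm g ^+ 2.
have e0 : 0 <= e := le_trans (nrm_ge0 _) hE.
rewrite leNgt; apply/negP => et.
have t0 : 0 < t by apply: le_lt_trans et; rewrite mulr_ge0.
have g0 : 0 < nrm g.
  by rewrite lt_neqAle nrm_ge0 andbT eq_sym; apply: contraTneq t0; rewrite /t => ->; rewrite expr0n ltxx.
pose p := b + star b; pose q := 'i *: (b - star b).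
have pp : star p = p by rewrite starD starK addrC.
have qq : star q = q by rewrite starZi starD starN starK /q; module.
have pq : p ** p + q ** q + (g ** g + g ** g) = 2%:R *: (b ** star b + E).
  rewrite /p /q /E -ascaleAl -ascaleAr scalerA -expr2 sqrCi.
  rewrite !(amulDl, amulDr, amulNl, amulNr); module.
have [M M0 hM] : exists2 M, 0 <= M & posb M (2%:R *: (b ** star b + E)).
  have P (x : B) : star x = x -> posb ((nrm x + 1) ^+ 2) (x ** x).
    by move=> xx; apply: posb_sqr; rewrite // ?ltr_wpDl ?nrm_ge0 // lerDl.
  exists ((nrm p + 1) ^+ 2 + (nrm q + 1) ^+ 2 + ((nrm g + 1) ^+ 2 + (nrm g + 1) ^+ 2)).
    by rewrite !addr_ge0 // exprn_ge0 // addr_ge0 ?nrm_ge0.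
  by rewrite -pq; do !apply: posbD; exact: P.
have L1 w : (t - e) * nrm w <= nrm (t%:C%C *: w + b ** star b ** w).
  have := posb_lower w hM (mulr_ge0 (ler0n R 2) (ltW t0)) M0.
  have -> : (2 * t)%:C%C *: w + 2%:R *: (b ** star b + E) ** w =
     2%:C%C *: ((t%:C%C *: w + b ** star b ** w) + E ** w).
    by rewrite rmorphM /= rmorph_nat -ascaleAl amulDl; module.
  rewrite nrmZr // -mulrA ler_pM2l // => H.
  have := le_trans H (nrmD _ _); have := nrmM E w.
  have := ler_wpM2r (nrm_ge0 w) hE; lra.
have bt : nrm b ^+ 2 <= t + e.
  rewrite -nrm_star_amul (_ : star b ** b = E - g ** g); last by rewrite /E addrK.
  by rewrite (le_trans (nrmB _ _)) // nrm_sqr // addrC lerD2l.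
(* For [y = t z + b^* b z], the identities [b y = t b z + b b^* b z] and [t z = y - b^* b z] carry
   the lower bound [L1] from [b b^*] over to [b^* b]. *)
have L2 z : ((t - e) / 2) * nrm z <= nrm (t%:C%C *: z + star b ** b ** z).
  set y := t%:C%C *: z + _.
  have h1 : (t - e) * nrm (b ** z) <= nrm b * nrm y.
    rewrite (le_trans (L1 _)) // (le_trans _ (nrmM _ _)) //.
    by rewrite /y amulDr -ascaleAr !amulA.
  have h2 : t * nrm z <= nrm y + nrm b * nrm (b ** z).
    rewrite -(nrmZr _ (ltW t0)) (_ : t%:C%C *: z = y - star b ** (b ** z)).
      by rewrite (le_trans (nrmB _ _)) // lerD2l (le_trans (nrmM _ _)) // nrm_star.
    by rewrite /y amulA addrK.
  have te : 0 < t - e by lra.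
  have h3 : (t - e) * (t * nrm z) <= (t - e) * nrm y + nrm b * (nrm b * nrm y).
    rewrite (le_trans (ler_wpM2l (ltW te) h2)) // mulrDr lerD2l mulrCA.
    by rewrite ler_wpM2l ?nrm_ge0.
  have h4 : nrm b * (nrm b * nrm y) <= (t + e) * nrm y.
    by rewrite mulrA -expr2 ler_wpM2r ?nrm_ge0.
  have h5 : t * ((t - e) * nrm z) <= t * (2 * nrm y) by lra.
  by rewrite ler_pM2l // in h5; lra.
have L3 z : ((t - e) / 2 - e) * nrm z <= nrm (t%:C%C *: z - g ** g ** z).
  have := le_trans (L2 z) (nrm_leB _ (t%:C%C *: z - g ** g ** z)).
  have -> : t%:C%C *: z + star b ** b ** z - (t%:C%C *: z - g ** g ** z) = E ** z.
    by rewrite /E amulDl; module.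
  have := nrmM E z; have := ler_wpM2r (nrm_ge0 z) hE; lra.
(* Here the constant is [(t - 3 e) / 2], so [2 t - 6 e <= t], contrary to [6 e < t]. *)
have := top_spectrum gg g0 L3; rewrite -/t; lra.
Qed.

End Positive.



(** * Approximate absolute values and the positivity of [a^* a] *)

Lemma bnd_exists (R : realType) (B : cstarAlgType R) (h : B) (p : {poly R}) :
  exists2 N, 1 <= N & bnd h p N.
Proof.
elim/poly_ind: p => [|p c [N N1 hN]].
  by exists 1 => //; apply: bndW (bnd0 h).
have N0 : 0 <= N := le_trans ler01 N1.
exists (N * nrm h + `|c| + 1); first by rewrite lerDr addr_ge0 ?mulr_ge0 ?nrm_ge0.
apply: bndW (bndD (bndM N0 hN (bndX (lexx (nrm h)))) (bndC h c)).
by rewrite lerDl.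
Qed.

(** Bernoulli's inequality in the form [x^n (1 + n (1 - x)) <= 1]. *)
Lemma expr_small (R : realType) (x e : R) : 0 <= x < 1 -> 0 < e ->
  exists n, x ^+ n <= e.
Proof.
move=> /andP[x0 x1] e0; pose d := 1 - x.
have d0 : 0 < d by rewrite subr_gt0.
have bern n : x ^+ n * (1 + n%:R * d) <= 1.
  elim: n => [|n IH]; first by rewrite expr0 mul0r addr0 mulr1.
  apply: le_trans IH; rewrite exprSr -mulrA ler_wpM2l ?exprn_ge0 //.
  rewrite -natr1; have : 0 <= n%:R :> R by [].
  by have := sqr_ge0 (1 - x); rewrite /d; set m := n%:R; nra.
have ed0 : 0 < (e * d)^-1 by rewrite invr_gt0 mulr_gt0.
have hn := archi_boundP (ltW ed0).
set n := Num.bound _ in hn; exists n.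
have := bern n; have xn : 0 <= x ^+ n by rewrite exprn_ge0.
rewrite -[_^-1]mul1r ltr_pdivrMr ?mulr_gt0 // in hn.
set m : R := n%:R in hn *; set y := x ^+ n in xn *.
rewrite leNgt => H; rewrite leNgt; apply/negP => ey; move: H; apply/negP.
rewrite negbK (lt_le_trans hn) // (_ : m * (e * d) = e * (m * d)); last by ring.
by apply: ler_pM; rewrite ?mulr_ge0 ?ler0n ?(ltW e0) ?(ltW d0) ?(ltW ey) // ler_wpDl.
Qed.

(* [P('X^2)] approximates [('X^2 + d^2)^(-1/2)], while [r] and [rho] approximate
   [('X^2 + d^2)^(1/2)] and its square root. *)
Lemma approx_rsqrt (R : realType) (B : cstarAlgType R) (h : B) (d e : R) :
    star h = h -> nrm h <= 2^-1 -> 0 < d <= 2^-1 -> 0 < e <= 1 ->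
  exists P r rho : {poly R}, let eta := P \Po 'X^2 in
    [/\ bnd h (('X^2 + (d ^+ 2)%:P) * eta ^+ 2 - 1) e, bnd h (r * eta - 1) e,
        bnd h (rho ^+ 2 - r) e, bnd h r 2 & bnd h rho 2].
Proof.
move=> hh h2 /andP[d0 d2] /andP[e0 e1].
pose K : {poly R} := (1 - d ^+ 2)%:P - 'X; pose k := K \Po 'X^2.
have kE : 1 - k = 'X^2 + (d ^+ 2)%:P.
  rewrite /k /K comp_polyB comp_polyX comp_polyC polyCB polyC1; ring.
have x01 : 0 <= 1 - d ^+ 2 < 1 by apply/andP; split; nra.
have hk : bnd h k (1 - d ^+ 2).
  have b2X : bnd h (2 *: 'X) 1.
    by have := bndZ 2 (bndX h2); rewrite ger0_norm // mulfV.
  (* Splits [k] as [(3 / 4 - d^2) + (1 - (2 X)^2) / 4], where [2 h] is a contraction. *)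
  have := bndD (bndC h (3 / 4 - d ^+ 2)) (bndZ 4^-1 (bnd_one_sub_sqr hh b2X)).
  rewrite ger0_norm ?[`|4^-1|]ger0_norm ?invr_ge0 //; last by nra.
  rewrite (_ : _ + _ = k); first by apply: bndW; lra.
  rewrite /k /K comp_polyB comp_polyX comp_polyC exprZn scalerBr scalerA.
  rewrite -mul_polyC mulr1 (_ : 4^-1 * 2 ^+ 2 = 1 :> R); last by field.
  rewrite scale1r addrA -polyCD; congr (_%:P - _).
  by field.
have [J hJ] := expr_small x01 (divr_gt0 e0 (ltr0Sn R 5)).
(* [z] is the truncated geometric series for [1 / (1 - k)]. *)
pose Z : {poly R} := \sum_(i < J) K ^+ i; pose z := Z \Po 'X^2.
have zE : (1 - k) * z = 1 - k ^+ J.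
  rewrite /z /k /Z; move: (K) => K0.
  have : (K0 ^+ J - 1) \Po 'X^2 = ((K0 - 1) * \sum_(i < J) K0 ^+ i) \Po 'X^2.
    by rewrite subrX1.
  rewrite comp_polyM !comp_polyB rmorphXn /= -[1]/(1%:P) comp_polyC => H.
  by apply: oppr_inj; rewrite -mulNr !opprB -H.
have [N N1 hN] := bnd_exists h z.
have N0 : 0 < N := lt_le_trans ltr01 N1.
have hkJ : bnd h (k ^+ J) (e / 6).
  apply: bndW hJ _; elim: J {Z z zE hN} => [|J IH]; first exact: bnd1.
  by rewrite exprS [X in bnd _ _ X]exprS; apply: bndM => //; case/andP: x01.
have hk1 : bnd h k 1 by apply: bndW hk; have := sqr_ge0 d; lra.
have e'0 : 0 < e / 6 / N by rewrite !divr_gt0.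
have [V /(_ _ _ _ hk1) [hV1]] := approx_sqrt e'0.
set r := 1 - _; set e2 := _ - _ => he2.
have [W /(_ _ _ _ hV1) [hW1 hW]] := approx_sqrt e0.
(* As [r ~ (1 - k)^(1/2)] and [z ~ (1 - k)^(-1)], their product is [~ (1 - k)^(-1/2)]. Since [r] is
   [1] minus the contraction [V(k)], the polynomial [W] yields its square root. *)
exists ((1 - (V \Po K)) * Z), r, (1 - (W \Po (V \Po k))) => eta.
have etaE : eta = r * z.
  by rewrite /eta comp_polyM comp_polyB -[1]/(1%:P) comp_polyC -comp_polyA.
have hze : bnd h (z * e2) (e / 6).
  by apply: bndW (bndM (ltW N0) hN he2); rewrite mulrC divfK ?gt_eqF.
have h12 : 1 + 1 = 2 :> R by [].
split; last 3 first.
- suff -> : (1 - (W \Po (V \Po k))) ^+ 2 - r =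
    (1 - (W \Po (V \Po k))) ^+ 2 - (1 - (V \Po k)) by [].
  by rewrite /r.
- by rewrite -h12; apply: bndB => //; exact: bnd1.
- by rewrite -h12; apply: bndB => //; exact: bnd1.
- have -> : ('X^2 + (d ^+ 2)%:P) * eta ^+ 2 - 1 =
      ((1 - k ^+ J) * (z * e2) - k ^+ J) + (k ^+ J * k ^+ J - k ^+ J).
    rewrite -kE etaE -zE /e2.
    transitivity (((1 - k) * z) ^+ 2 + (1 - k) * z * (z * (r ^+ 2 - (1 - k))) - 1).
      by ring.
    by rewrite zE; ring.
  have b1 := bndB (bnd1 h) hkJ.
  have b10 : 0 <= 1 + e / 6 by rewrite addr_ge0 // divr_ge0 // ltW.
  have e60 : 0 <= e / 6 by rewrite divr_ge0 // ltW.
  apply: bndW (bndD (bndB (bndM b10 b1 hze) hkJ) (bndB (bndM e60 hkJ hkJ) hkJ)).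
  nra.
have -> : r * eta - 1 = z * e2 - k ^+ J.
  rewrite etaE /e2.
  transitivity (z * (r ^+ 2 - (1 - k)) + (1 - k) * z - 1); first by ring.
  by rewrite zE; ring.
by apply: bndW (bndB hze hkJ); lra.
Qed.

Section SquareApproximation.
Variables (R : realType) (B : cstarAlgType R).

(* With [h = a^* a], [s ~ sgn h] and [b = a h (1 - s)], one gets
   [b^* b ~ - g^2] where [g = h |h|^(1/2) (1 - s)]; hence [h (1 - s) ~ 0], and
   [h ~ h s ~ (s |h|^(1/2))^2]. *)
Lemma approx_sqr_small (a : B) (e : R) : nrm a ^+ 2 <= 2^-1 -> 0 < e ->
  exists2 q, star q = q & nrm (star a ** a - q ** q) <= e.
Proof.
move=> a2 e0; set h := star a ** a.
have hh : star h = h by rewrite starM starK.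
have h2 : nrm h <= 2^-1 by rewrite nrm_star_amul.
(* The scales are [c = f^2] and [d = f^4]: two square roots are lost, first in
   [|g|^2 <= 36 d = (6 c)^2], then in [|G|^2 <= 100 c = (10 f)^2]. *)
pose f := Num.min 2^-1 (e / 13).
have f0 : 0 < f by rewrite lt_min invr_gt0 ltr0n divr_gt0.
have f2 : f <= 2^-1 by rewrite ge_min lexx.
have fe : 13 * f <= e by rewrite mulrC -ler_pdivlMr // ge_min lexx orbT.
pose c := f ^+ 2; pose d := c ^+ 2.
have c0 : 0 < c by rewrite exprn_gt0.
have d0 : 0 < d by rewrite exprn_gt0.
have cf : c <= f / 2 by rewrite /c; nra.
have dc : d <= c / 2 by rewrite /d; nra.
have dd : d ^+ 2 <= d / 2 by nra.
have d2 : 0 < d <= 2^-1 by apply/andP; split => //; lra.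
have e1 : 0 < d ^+ 2 <= 1 by apply/andP; split; [rewrite exprn_gt0|lra].
case: (approx_rsqrt hh h2 d2 e1) => P [r] [rho]; set eta := P \Po _.
move=> /= [he3 he4 he5 hr ho].
set e3 := _ - 1 in he3; set e4 := _ - 1 in he4; set e5 := _ - r in he5.
(* [y] completes [s] to [s^2 + y^2 ~ 1], which bounds both. *)
pose s := 'X * eta; pose y := d%:P * eta.
have hsy : bnd h (s ^+ 2 + y ^+ 2) (1 + d ^+ 2).
  have -> : s ^+ 2 + y ^+ 2 = 1 + e3 by rewrite /s /y /e3 [(d ^+ 2)%:P]polyC_exp; ring.
  exact: bndD (bnd1 h) he3.
have d20 : 0 <= d ^+ 2 by rewrite exprn_ge0 // ltW.
have b2 : 1 + d ^+ 2 <= 2 by lra.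
have hs : bnd h s 2 by apply: bndW b2 (bnd_two_squares1 hh d20 hsy).
have hy : bnd h y 2.
  by apply: bndW b2 (bnd_two_squares1 hh d20 _); rewrite addrC; exact: hsy.
have hs1 : bnd h (1 - s) 3 by apply: bndW (bndB (bnd1 h) hs); lra.
have hX : bnd h 'X 2^-1 by exact: bndX.
have h2' : 0 <= 2^-1 :> R by rewrite invr_ge0.
pose G := pact h (1 - s) h; pose g := pact h (rho * (1 - s)) h.
have GG : star G = G by exact: pact_herm.
have gg : star g = g by exact: pact_herm.
have hg : nrm g <= 6 * c.
  pose b := a ** G.
  (* The sum is [X (1 - s)^2 (X + rho^2)] applied to [h]. From [r s ~ X] and [rho^2 ~ r] one gets
     [X + rho^2 ~ r (1 + s)], and [r (1 - s^2) ~ r y^2 ~ d y] is small. *)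
  pose Q := 'X * (1 - s) * (d%:P * (y * (1 + e4)) - r * e3)
            + 'X * (1 - s) * (1 - s) * (e5 - 'X * e4).
  have bE : star b ** b + g ** g = pact h Q h.
    have -> : star b ** b = pact h ((1 - s) * 'X * ('X * (1 - s))) h.
      rewrite /b starM GG -amulA [star a ** _]amulA -/h pactM -pactXM.
      by rewrite pactM pactX.
    have -> : g ** g = pact h (rho * (1 - s) * 'X * (rho * (1 - s))) h.
      by rewrite pactXM [RHS]pactM.
    rewrite -pactD; congr (pact h _ h).
    by rewrite /Q /y /e4 /e3 /e5 /s [(d ^+ 2)%:P]polyC_exp; ring.
  have hQ : bnd h Q (12 * d).
    have h1e4 : bnd h (1 + e4) 2 by apply: bndW (bndD (bnd1 h) he4).
    have hdC : bnd h d%:P d by have := bndC h d; rewrite ger0_norm // ltW.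
    have A := bndB (bndM (ltW d0) hdC (bndM (ler0n _ 2) hy h1e4)) (bndM (ler0n _ 2) hr he3).
    have D := bndB he5 (bndM h2' hX he4).
    have E1 := bndM h2' hX hs1.
    have E10 : 0 <= 2^-1 * 3 :> R by rewrite mulr_ge0.
    have E2 := bndM E10 E1 hs1.
    have E20 : 0 <= 2^-1 * 3 * 3 :> R by rewrite mulr_ge0.
    by apply: bndW (bndD (bndM E10 E1 A) (bndM E20 E2 D)); lra.
  have : nrm (star b ** b + g ** g) <= 6 * d.
    rewrite bE (le_trans (hQ h)) //.
    by apply: le_trans (ler_wpM2l _ h2) _; rewrite ?mulr_ge0 ?(ltW d0) //; lra.
  move/(neg_sqr_bound gg) => H.
  have c60 : 0 <= 6 * c by rewrite mulr_ge0 // ltW.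
  rewrite -(@ler_pXn2r _ 2) ?nnegrE ?nrm_ge0 // (le_trans H) // exprMn /d.
  by rewrite mulrA ler_wpM2r ?exprn_ge0 ?(ltW c0) //; lra.
have hG : nrm G <= 10 * f.
  have hGG : nrm (G ** G) <= 100 * c.
    (* Since [X ~ s rho^2], the square of [G] is almost [(1 - s) s rho] applied to the small [g]. *)
    pose Q := (1 - s) * s * e5 * (1 - s) + 'X * e4 * (1 - s) * (1 - s).
    have -> : G ** G = pact h ((1 - s) * s * rho) g - pact h Q h.
      rewrite /g -pactM -pactB {1}/G pactXM /G -pactM; congr (pact h _ h).
      by rewrite /Q /e4 /e5 /s; ring.
    have hQ : bnd h Q (12 * d).
      have A := bndM (mulr_ge0 (mulr_ge0 (ler0n _ 3) (ler0n _ 2)) d20)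
        (bndM (mulr_ge0 (ler0n _ 3) (ler0n _ 2)) (bndM (ler0n _ 3) hs1 hs) he5) hs1.
      have E1 := bndM (mulr_ge0 h2' d20) (bndM h2' hX he4) hs1.
      have E2 := bndM (mulr_ge0 (mulr_ge0 h2' d20) (ler0n _ 3)) E1 hs1.
      by apply: bndW (bndD A E2); lra.
    have hT := bndM (mulr_ge0 (ler0n _ 3) (ler0n _ 2)) (bndM (ler0n _ 3) hs1 hs) ho.
    rewrite (le_trans (nrmB _ _)) //.
    have := hT g; have := hQ h.
    have : 12 * d * nrm h <= 6 * d.
      by apply: le_trans (ler_wpM2l _ h2) _; rewrite ?mulr_ge0 ?(ltW d0) //; lra.
    lra.
  rewrite -(@ler_pXn2r _ 2) ?nnegrE ?nrm_ge0 ?mulr_ge0 ?(ltW f0) //.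
  by rewrite -nrm_sqr // exprMn -natrX.
exists (pact h (eta * rho) h); first exact: pact_herm.
(* [eta] is controlled only through [y = d eta], whence the factor [d^-1]; the bound [d^2] on [e5]
   outweighs it. *)
pose Q := s * e4 + d^-1 *: (s * y * e5).
have -> : h - pact h (eta * rho) h ** pact h (eta * rho) h = G - pact h Q h.
  rewrite pactXM /G -pactM -pactB -[X in X - _](pact1 h) -pactB; congr (pact h _ h).
  have dd1 : d^-1 *: (s * y * e5) = s * eta * e5.
    rewrite /y -mul_polyC.
    transitivity (((d^-1)%:P * d%:P) * (s * eta * e5)); first by ring.
    by rewrite -polyCM mulVf ?gt_eqF // polyC1 mul1r.
  by rewrite /Q dd1 /e4 /e5 /s; ring.
have hQ : bnd h Q (5 * d).
  have A := bndM (mulr_ge0 (ler0n _ 2) (ler0n _ 2)) (bndM (ler0n _ 2) hs hy) he5.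
  apply: bndW (bndD (bndM (ler0n _ 2) hs he4) (bndZ d^-1 A)).
  rewrite ger0_norm ?invr_ge0 ?(ltW d0) // (_ : d^-1 * _ = 4 * d); first by lra.
  by field; rewrite gt_eqF.
rewrite (le_trans (nrmB _ _)) //.
have : nrm (pact h Q h) <= 5 * d * 2^-1.
  by apply: le_trans (hQ h) (ler_wpM2l _ h2); rewrite mulr_ge0 // ltW.
lra.
Qed.

Lemma approx_sqr (a : B) (e : R) : 0 < e ->
  exists2 q, star q = q & nrm (star a ** a - q ** q) <= e.
Proof.
move=> e0; pose c := (2 * (nrm a + 1))^-1.
have a1 : 0 < nrm a + 1 by rewrite ltr_wpDl ?nrm_ge0.
have c0 : 0 < c by rewrite invr_gt0 mulr_gt0.
have ca : nrm (c%:C%C *: a) ^+ 2 <= 2^-1.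
  have H : nrm (c%:C%C *: a) <= 2^-1.
    rewrite nrmZr ?(ltW c0) // mulrC ler_pdivrMr ?mulr_gt0 //.
    by rewrite mulrA mulVf // mul1r lerDl.
  by have := nrm_ge0 (c%:C%C *: a); move: H; set n := nrm _; nra.
have [q qq hq] := approx_sqr_small ca (mulr_gt0 (exprn_gt0 2 c0) e0).
exists ((c^-1)%:C%C *: q); first by rewrite starZr qq.
have -> : star a ** a - (c^-1)%:C%C *: q ** ((c^-1)%:C%C *: q) =
   ((c^-1) ^+ 2)%:C%C *: (star (c%:C%C *: a) ** (c%:C%C *: a) - q ** q).
  rewrite starZr -!ascaleAl -!ascaleAr !scalerA -!rmorphM -!expr2 scalerBr scalerA.
  by rewrite -rmorphM /= -exprMn mulVf ?gt_eqF // expr1n scale1r.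
have c2 : 0 < c ^+ 2 by rewrite exprn_gt0.
rewrite nrmZr exprVn ?invr_ge0 ?(ltW c2) //.
by rewrite mulrC ler_pdivrMr // [e * _]mulrC.
Qed.

(** [a^* a] is a limit of squares of hermitian elements, which are positive by [posb_sqr]. *)
Lemma posb_star_amul (a : B) : posb ((nrm a + 1) ^+ 2) (star a ** a).
Proof.
apply: posb_limit => e e0 e1; have [q qq hq] := approx_sqr a e0; exists (q ** q) => //.
apply: posbW (_ : (nrm a + 1) ^+ 2 <= _) _; first by rewrite lerDl ltW.
have a0 := nrm_ge0 a.
apply: posb_sqr; rewrite ?ltr_wpDl //.
rewrite -(@ler_pXn2r _ 2) ?nnegrE ?nrm_ge0 ?addr_ge0 // -nrm_sqr //.
have := nrm_leB (q ** q) (star a ** a); rewrite nrm_star_amul nrmC; lra.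
Qed.

(** If [p^2 ~ d^* d], then [|p|^2 - p^2 ~ |p|^2 + q - s] is bounded below by [|p|^2 - |s|], and
    [top_spectrum] gives [3 |p|^2 <= 4 |s|] up to errors. *)
Lemma star_amul_dominated (M : R) (d q s : B) : 0 <= M -> posb M q ->
  star d ** d + q = s -> nrm d ^+ 2 <= 2 * nrm s.
Proof.
move=> M0 hq dqs; apply: (@le_limit _ _ _ 3) => // e e0 e1.
have [p pp hp] := approx_sqr d e0.
have dp : nrm d ^+ 2 <= nrm p ^+ 2 + e.
  by rewrite -nrm_star_amul -nrm_sqr // (le_trans (nrm_leB _ (p ** p))) // lerD2l.
have s0 := nrm_ge0 s.
have [p0|p0] := eqVneq (nrm p) 0; first by move: dp; rewrite p0 expr0n /=; lra.
have {}p0 : 0 < nrm p by rewrite lt_neqAle eq_sym p0 nrm_ge0.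
suff : 4 * (nrm p ^+ 2 - nrm s - e) <= nrm p ^+ 2 by lra.
apply: top_spectrum => // w; set t := nrm p ^+ 2.
have t0 : 0 <= t by rewrite exprn_ge0 ?nrm_ge0.
have := posb_lower w hq t0 M0; set A := _ + q ** w.
have -> : t%:C%C *: w - p ** p ** w = A - (s ** w - (star d ** d - p ** p) ** w).
  by rewrite /A -dqs !amulDl amulNl; module.
set E := (s ** w - _); have := nrm_leB A (A - E).
rewrite (_ : A - (A - E) = E); last by module.
have := nrmB (s ** w) ((star d ** d - p ** p) ** w); rewrite -/E.
have := nrmM s w; have := nrmM (star d ** d - p ** p) w.
have := ler_wpM2r (nrm_ge0 w) hp; lra.
Qed.

End SquareApproximation.



(** * Contractive Jordan-triple multiplicative pairs *)

Section Pairs.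
Variables (R : realType) (B : cstarAlgType R).
Implicit Types (u c s t : B).

(** The element is almost [v^* v], where [v = o u] and [o] approximates the square root of
    [1 - c^* c]. *)
Lemma posb_contraction c u : nrm c <= 1 ->
  posb ((2 * nrm u + 1) ^+ 2) (star u ** u - star (c ** u) ** (c ** u)).
Proof.
move=> c1; apply: posb_limit => e e0 e1; have u0 := nrm_ge0 u.
pose k := star c ** c; have kk : star k = k by rewrite starM starK.
have hX : bnd k 'X 1 by apply: bndX; rewrite nrm_star_amul expr_le1 ?nrm_ge0.
have e'0 : 0 < e / (nrm u ^+ 2 + 1) by rewrite divr_gt0 // ltr_wpDl ?exprn_ge0.
have [V /(_ _ _ _ hX) [hV]] := approx_sqrt e'0.
set o := 1 - _; set r := _ - _ => hr.
have ho : bnd k o 2 by apply: bndW (bndB (bnd1 k) hV).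
exists (star (pact k o u) ** pact k o u).
  rewrite pact_adj // -pactM -expr2 (_ : o ^+ 2 = r + (1 - 'X)); last by rewrite /r; ring.
  rewrite pactD (pactB k 1 'X) pact1 pactX amulDr starM.
  have -> : star u ** u - star u ** star c ** (c ** u) -
      (star u ** pact k r u + star u ** (u - k ** u)) = - (star u ** pact k r u).
    by rewrite /k !(amulDr, amulNr) !amulA; module.
  rewrite nrmN (le_trans (nrmM _ _)) // nrm_star.
  have H := ler_wpM2l u0 (hr u); rewrite (le_trans H) //.
  rewrite mulrCA -expr2 mulrAC ler_pdivrMr ?ltr_wpDl ?exprn_ge0 //.
  by rewrite ler_wpM2l ?(ltW e0) // lerDl.
apply: posbW (posb_star_amul _).
have h1 : nrm (pact k o u) + 1 <= 2 * nrm u + 1 by rewrite lerD2r.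
have h0 : 0 <= nrm (pact k o u) + 1 by rewrite addr_ge0 ?nrm_ge0.
by apply: le_trans (_ : (2 * nrm u + 1) ^+ 2 <= _); [nra | rewrite lerDl ltW].
Qed.

(** Expansion of a square as in a Hilbert space: the defects of the contractions [t] and [s^*] form
    a positive [q], and [d^* d + q = - u^* v - v^* u]. *)
Lemma contraction_pair s t u : nrm s <= 1 -> nrm t <= 1 ->
  nrm (t ** u - star s ** u) ^+ 2 <= 4 * nrm u * nrm (s ** t ** u - u).
Proof.
move=> s1 t1; have ss1 : nrm (star s) <= 1 by rewrite nrm_star.
have := posbD (posb_contraction u t1) (posb_contraction u ss1).
set M := _ + _; set q := _ + _ => hq; set d := _ - _.
have M0 : 0 <= M by rewrite addr_ge0 // sqr_ge0.
set v := s ** t ** u - u.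
have E : star d ** d + q = - (star u ** v) - star v ** u.
  rewrite /d /q /v !(starD, starN, starM, starK, amulDl, amulDr, amulNl, amulNr, amulA).
  by module.
have := star_amul_dominated M0 hq E.
have := nrmB (- (star u ** v)) (star v ** u); rewrite nrmN.
have := nrmM (star u) v; have := nrmM (star v) u; rewrite !nrm_star.
lra.
Qed.

Lemma almost_contraction_pair (m : R) s t u : 1 <= m -> nrm s <= m -> nrm t <= m ->
  nrm (t ** u - star s ** u) ^+ 2 <=
    4 * nrm u * (nrm (s ** t ** u - u) + (m ^+ 2 - 1) * nrm u).
Proof.
move=> m1 sm tm; have m0 : 0 < m := lt_le_trans ltr01 m1.
have m'0 : 0 <= m^-1 by rewrite invr_ge0 ltW.
have N (c : B) : nrm c <= m -> nrm ((m^-1)%:C%C *: c) <= 1.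
  by move=> cm; rewrite nrmZr // mulrC ler_pdivrMr // mul1r.
have := contraction_pair u (N _ sm) (N _ tm).
rewrite starZr -!ascaleAl -!ascaleAr -!ascaleAl scalerA -scalerBr nrmZr //.
have -> : ((m^-1)%:C%C * (m^-1)%:C%C) *: (s ** t ** u) - u =
  (m^-1 ^+ 2)%:C%C *: ((s ** t ** u - u) - (m ^+ 2 - 1)%:C%C *: u).
  rewrite scalerBr scalerA -!rmorphM /= mulrBr mulr1 -exprMn mulVf ?gt_eqF // expr1n.
  by rewrite rmorphB /= rmorph1 rmorphM /= -expr2; module.
set v := s ** t ** u - u; rewrite exprMn nrmZr ?exprn_ge0 //.
have mm : 0 < m^-1 ^+ 2 by rewrite exprn_gt0 // invr_gt0.
rewrite [X in _ <= X]mulrCA ler_pM2l // => H; apply: le_trans H _.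
rewrite ler_wpM2l ?mulr_ge0 ?nrm_ge0 // (le_trans (nrmB _ _)) // nrmZr //.
by rewrite subr_ge0 expr_ge1 // ltW.
Qed.

(** Left multiplication by [c] attains the norm of [c] at [z = star c]. *)
Lemma nrm_le_op (c : B) M : 0 <= M -> (forall z, nrm (c ** z) <= M * nrm z) -> nrm c <= M.
Proof.
move=> M0 H; have := H (star c); rewrite nrm_amul_star nrm_star expr2.
have [->|c0] := eqVneq (nrm c) 0; first by [].
by rewrite ler_pM2r // lt_neqAle eq_sym c0 nrm_ge0.
Qed.

Lemma nrm_pact_le (h : B) p M : 0 <= M -> bnd h (p * 'X) M -> nrm (pact h p h) <= M.
Proof. by move=> M0 H; apply: nrm_le_op => // z; rewrite pactXM. Qed.

End Pairs.

(** * Odd polynomials under a Jordan-triple multiplicative pair *)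

Section JordanPairs.
Variables (R : realType) (A B : cstarAlgType R).

Lemma jordan_triple_sym (Phi Psi : A -> B) :
  jordan_triple_multiplicative Phi Psi -> jordan_triple_multiplicative Psi Phi.
Proof. by case. Qed.

Lemma pact_Xn (C : cstarAlgType R) (h w : C) n : pact h 'X^n w = iter n (amul h) w.
Proof. by elim: n w => [|n IH] w; rewrite ?pact1 // exprSr pactMX IH -iterSr. Qed.

(** Induction through [a^(2n+3) = a a^(2n+1) a]; each step swaps the two maps, so both claims
    advance together. *)
Lemma jordan_odd_power (Phi Psi : A -> B) a n : jordan_triple_multiplicative Phi Psi ->
  Phi (iter n (amul (a ** a)) a) = iter n (amul (Phi a ** Psi a)) (Phi a) /\
  Psi (iter n (amul (a ** a)) a) = iter n (amul (Psi a ** Phi a)) (Psi a).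
Proof.
move=> [h1 h2]; elim: n => [|n [IH1 IH2]] //.
have -> : iter n.+1 (amul (a ** a)) a = a ** iter n (amul (a ** a)) a ** a.
  by rewrite iterSr -!pact_Xn -!pact_comp_sqr -pact_mulX pact_amul.
rewrite h1 h2 IH1 IH2 -!pact_Xn !pact_intertwine !pact_amul.
by rewrite exprSr !pactMX.
Qed.

Variables (Phi Psi : {linear A -> B}).
Hypothesis hJ : jordan_triple_multiplicative Phi Psi.

Lemma jordan_pact (a : A) (P : {poly R}) :
  Phi (pact (a ** a) P a) = pact (Phi a ** Psi a) P (Phi a) /\
  Psi (pact (a ** a) P a) = pact (Psi a ** Phi a) P (Psi a).
Proof.
rewrite /pact !linear_sum.
split; apply: eq_bigr => i _; rewrite linearZ.
  by rewrite (proj1 (jordan_odd_power a i hJ)).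
by rewrite (proj2 (jordan_odd_power a i hJ)).
Qed.

Lemma jordan_pact_mul (a : A) (P Q : {poly R}) :
  Phi (pact (a ** a) P a) ** Psi (pact (a ** a) Q a) ** Phi a =
  Phi (pact (a ** a) (P * Q * 'X) a).
Proof.
rewrite !(proj1 (jordan_pact _ _)) (proj2 (jordan_pact _ _)).
by rewrite !pact_amul pact_intertwine pact_amul pactMX pactM.
Qed.

Hypothesis Phi1 : contractive Phi.
Hypothesis Psi1 : contractive Psi.

Lemma contractive_nrm (T : A -> B) a : contractive T -> nrm (T a) <= nrm a.
Proof. by move=> /(_ a); rewrite !nrmE lecR. Qed.

(* [a ~ s c] is the imaginary part of [f = s (w + i c)], where [s ~ sgn a],
   [c ~ |a|] and [w = sqrt (1 - c^2)]. As [f] is odd in [a] and [f f^* a ~ a],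
   [(Phi f, Psi f^* )] is almost a pair of mutually inverse contractions on
   [Phi a], whence [Psi f^* Phi a ~ (Phi f)^* Phi a]; so also for [f^*], and
   for [a] by linearity. *)
Lemma jordan_star_small (a : A) : star a = a -> nrm a <= 2^-1 ->
  (Psi a - star (Phi a)) ** Phi a = 0.
Proof.
move=> aa a2; apply: nrm_eq0; apply/eqP; rewrite eq_le nrm_ge0 andbT.
apply: (@le_limit _ _ _ 11) => // e e0 e1; rewrite add0r.
(* The contraction estimate bounds a square by a multiple of [d], so the distance in [key] is of
   order [g]. *)
pose g := e / 2; pose d := g ^+ 2.
have g0 : 0 < g by rewrite divr_gt0.
have d0 : 0 < d by rewrite exprn_gt0.
have dg : d <= g / 2 by rewrite /d /g; nra.
have d2 : d <= 2^-1 by rewrite /d /g; nra.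
have d01 : 0 < d <= 2^-1 by rewrite d0.
have d11 : 0 < d <= 1 by apply/andP; split=> //; lra.
case: (approx_rsqrt aa a2 d01 d11) => P [r] [rho]; set eta := P \Po _.
move=> /= [he3 _ _ _ _]; set e3 := _ - 1 in he3.
pose s := 'X * eta; pose y := d%:P * eta.
have hsy : bnd a (s ^+ 2 + y ^+ 2) (1 + d).
  have -> : s ^+ 2 + y ^+ 2 = 1 + e3 by rewrite /s /y /e3 [(d ^+ 2)%:P]polyC_exp; ring.
  exact: bndD (bnd1 a) he3.
have hs := bnd_two_squares1 aa (ltW d0) hsy.
have hy : bnd a y (1 + d).
  by apply: (bnd_two_squares1 aa (ltW d0)); rewrite addrC; exact: hsy.
have hX : bnd a 'X 2^-1 by exact: bndX.
have h2' : 0 <= 2^-1 :> R by rewrite invr_ge0.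
have d1 : 0 <= 1 + d by rewrite addr_ge0 // ltW.
pose c := 'X * s; have hc : bnd a c 1 by apply: bndW (bndM h2' hX hs); lra.
have hcc : bnd a (c ^+ 2) 1 by rewrite expr2 -[1]mulr1; exact: bndM.
have [V /(_ _ _ _ hcc) [_]] := approx_sqrt d0.
set w := 1 - _; set e6 := _ - _ => he6.
(* [U] and [W] are the even cofactors that exhibit [u ~ s w] and [v ~ s c] as odd polynomials in
   [a]. *)
pose U := P * (1 - (V \Po ('X * P) ^+ 2)); pose W := P * ('X * P).
have cE : ('X * P) \Po 'X^2 = c.
  by rewrite comp_polyM comp_polyX /c /s -/eta; ring.
have UE : U \Po 'X^2 = eta * w.
  rewrite comp_polyM comp_polyB -[1]/(1%:P) comp_polyC -comp_polyA rmorphXn /=.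
  by rewrite cE.
have WE : W \Po 'X^2 = eta * c.
  by rewrite comp_polyM cE.
pose u := pact a (eta * w) a; pose v := pact a (eta * c) a.
have uE : u = pact (a ** a) U a by rewrite -pact_comp_sqr UE.
have vE : v = pact (a ** a) W a by rewrite -pact_comp_sqr WE.
have uu : star u = u by exact: pact_herm.
have vv : star v = v by exact: pact_herm.
pose m := (1 + d) ^+ 2; have m1 : 1 <= m by rewrite expr_ge1 // lerDl ltW.
have m0 : 0 <= m by rewrite exprn_ge0.
have hse6 : bnd a (s ^+ 2 * (1 + e6)) (m * (1 + d)).
  by rewrite /m !expr2; apply: bndM (bndM d1 hs hs) (bndD (bnd1 a) he6); rewrite mulr_ge0.
have nf (k : R[i]) : k ^+ 2 = -1 -> (k^*)%R = - k -> nrm (u + k *: v) <= m.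
  move=> k2 kc; apply: nrm_le_op => // z.
  have E : star ((u + k *: v) ** z) ** ((u + k *: v) ** z) =
      star z ** pact a (s ^+ 2 * (1 + e6)) z.
    have -> : s ^+ 2 * (1 + e6) = (eta * w * 'X) * (eta * w * 'X) + (eta * c * 'X) * (eta * c * 'X).
      by rewrite /e6 /s; ring.
    have uz x : u ** x = pact a (eta * w * 'X) x by rewrite pactXM.
    have vz x : v ** x = pact a (eta * c * 'X) x by rewrite pactXM.
    rewrite starM starD starZ kc uu vv -amulA; congr (_ ** _).
    rewrite pactD (pactM a (eta * w * 'X)) (pactM a (eta * c * 'X)) -!uz -!vz !(amulDl, amulDr) -!ascaleAl -!ascaleAr.
    rewrite scalerA mulNr -expr2 k2 opprK scale1r.
    have -> : u ** (v ** z) = v ** (u ** z) by rewrite !uz !vz pactCM.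
    by module.
  rewrite -(@ler_pXn2r _ 2) ?nnegrE ?mulr_ge0 ?nrm_ge0 // -nrm_star_amul E.
  rewrite (le_trans (nrmM _ _)) // nrm_star.
  apply: le_trans (ler_wpM2l (nrm_ge0 z) (hse6 z)) _.
  have -> : nrm z * (m * (1 + d) * nrm z) = m * (1 + d) * nrm z ^+ 2 by ring.
  rewrite exprMn ler_wpM2r ?exprn_ge0 ?nrm_ge0 // [m ^+ 2]expr2 ler_wpM2l //.
  by rewrite /m expr2 ler_peMr // lerDl ltW.
(* As an operator [v - a] is [X (s^2 - 1) = X (e3 - y^2)], and [X y^2 = d s y] is small. *)
have hv : nrm (v - a) <= 3 * d.
  have -> : v - a = pact a (eta * c - 1) a by rewrite pactB pact1.
  apply: nrm_pact_le; first by rewrite mulr_ge0 // ltW.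
  have -> : (eta * c - 1) * 'X = 'X * e3 - d%:P * (s * y).
    by rewrite /c /s /y /e3 [(d ^+ 2)%:P]polyC_exp; ring.
  have hdC : bnd a d%:P d by have := bndC a d; rewrite ger0_norm // ltW.
  apply: bndW (bndB (bndM h2' hX he3) (bndM (ltW d0) hdC (bndM d1 hs hy))); nra.
set x := Phi a.
have x2 : nrm x <= 2^-1 by rewrite (le_trans (contractive_nrm _ Phi1)).
have key (k : R[i]) : k ^+ 2 = -1 -> (k^*)%R = - k ->
    nrm (Psi (u - k *: v) ** x - star (Phi (u + k *: v)) ** x) <= 5 * g.
  move=> k2 kc.
  have sm : nrm (Phi (u + k *: v)) <= m.
    by rewrite (le_trans (contractive_nrm _ Phi1)) // nf.
  have tm : nrm (Psi (u - k *: v)) <= m.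
    rewrite (le_trans (contractive_nrm _ Psi1)) // -scaleNr nf ?sqrrN //.
    by rewrite rmorphN /= kc.
  have := almost_contraction_pair x m1 sm tm.
  have -> : Phi (u + k *: v) ** Psi (u - k *: v) ** x =
      Phi (pact a (s ^+ 2 * (1 + e6)) a).
    have -> : s ^+ 2 * (1 + e6) = (U * U * 'X + W * W * 'X) \Po 'X^2.
      rewrite comp_polyD (comp_polyM (U * U)) (comp_polyM (W * W)) (comp_polyM U U).
      by rewrite (comp_polyM W W) comp_polyX UE WE /e6 /s; ring.
    rewrite pact_comp_sqr pactD [RHS]linearD -!jordan_pact_mul -/x -uE -vE.
    rewrite linearD linearB !linearZ /= !(amulDl, amulDr, amulNr, amulNl).
    rewrite -!ascaleAr -!ascaleAl !(amulNr, amulNl).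
    (* The mixed terms carry the coefficients [- k] and [k], so this equality cancels them. *)
    have -> : Phi u ** Psi v ** x = Phi v ** Psi u ** x.
      by rewrite uE vE !jordan_pact_mul [U * W]mulrC.
    by rewrite scalerA -expr2 k2 scaleN1r opprK; module.
  set E := nrm (_ - x).
  have hE : E <= 4 * d.
    rewrite /E /x -linearB (le_trans (contractive_nrm _ Phi1)) //.
    have -> : pact a (s ^+ 2 * (1 + e6)) a - a = pact a (s ^+ 2 * (1 + e6) - 1) a.
      by rewrite pactB pact1.
    apply: nrm_pact_le; first by rewrite mulr_ge0 // ltW.
    have -> : (s ^+ 2 * (1 + e6) - 1) * 'X = 'X * e3 - d%:P * (s * y) + s * s * e6 * 'X.
      by rewrite /s /y /e3 [(d ^+ 2)%:P]polyC_exp; ring.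
    have hdC : bnd a d%:P d by have := bndC a d; rewrite ger0_norm // ltW.
    have T1 := bndB (bndM h2' hX he3) (bndM (ltW d0) hdC (bndM d1 hs hy)).
    have T2 := bndM (mulr_ge0 (mulr_ge0 d1 d1) (ltW d0)) (bndM (mulr_ge0 d1 d1) (bndM d1 hs hs) he6) hX.
    apply: bndW (bndD T1 T2).
    have : (1 + d) * (1 + d) <= 9 / 4 by nra.
    by move=> ?; nra.
  have x0 := nrm_ge0 x; have E0 : 0 <= E := nrm_ge0 _.
  have m2 : m ^+ 2 - 1 <= 9 * d.
    rewrite /m -exprM; have d3 : d ^+ 3 <= d / 4 by rewrite exprS; nra.
    have d4 : d ^+ 4 <= d / 8 by rewrite exprS; nra.
    have d5 : d ^+ 2 <= d / 2 by nra.
    rewrite (_ : (1 + d) ^+ (2 * 2) = 1 + 4 * d + 6 * d ^+ 2 + 4 * d ^+ 3 + d ^+ 4); last by ring.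
    lra.
  move=> H; rewrite -(@ler_pXn2r _ 2) ?nnegrE ?nrm_ge0 ?mulr_ge0 ?(ltW e0) //.
  apply: le_trans H _.
  have mm0 : 0 <= m ^+ 2 - 1 by rewrite subr_ge0 expr_ge1.
  have F : E + (m ^+ 2 - 1) * nrm x <= 9 * d by nra.
  have G0 : 0 <= E + (m ^+ 2 - 1) * nrm x by rewrite addr_ge0 ?mulr_ge0.
  have x40 : 0 <= 4 * nrm x by rewrite mulr_ge0.
  have x42 : 4 * nrm x <= 2 by lra.
  apply: le_trans (ler_pM x40 G0 x42 F) _.
  by rewrite exprMn -/d -natrX mulrA ler_wpM2r ?(ltW d0) // -natrM ler_nat.
have k1 := key 'i (sqrCi _) (conjCi _).
have ni2 : (- 'i) ^+ 2 = -1 :> R[i] by rewrite sqrrN sqrCi.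
have nic : ((- 'i)^*)%R = - - 'i :> R[i] by rewrite rmorphN /= conjCi.
have k2 := key (- 'i) ni2 nic.
have hvx : nrm ((Psi v - star (Phi v)) ** x) <= 5 * g.
  (* Subtracting the estimates for [i] and [- i] eliminates [u]. *)
  have := nrmB (Psi (u - 'i *: v) ** x - star (Phi (u + 'i *: v)) ** x)
    (Psi (u - - 'i *: v) ** x - star (Phi (u + - 'i *: v)) ** x).
  set Z := _ - (_ - _).
  have -> : Z = (- 2 * 'i) *: ((Psi v - star (Phi v)) ** x).
    rewrite /Z !(linearD, linearN, linearZ) /= !(starD, starN, starZ) nic conjCi.
    by rewrite !(amulDl, amulNl, =^~ ascaleAl); module.
  rewrite nrmZ normrM normCi mulr1 normrN normr_nat [complex.Re _]/= => H.
  have half (p q : R) : (1 + 1) * p <= q + q -> p <= q by lra.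
  exact: half (le_trans H (lerD k1 k2)).
rewrite (_ : (Psi a - star x) ** x = (Psi v - star (Phi v)) ** x -
    (Psi (v - a) ** x - star (Phi (v - a)) ** x)); last first.
  by rewrite !linearB !(starD, starN) !(amulDl, amulNl) -/x; module.
have dist (T : B) : nrm T <= nrm (v - a) -> nrm (T ** x) <= 3 * d / 2.
  move=> hT; apply: le_trans (nrmM _ _) _.
  by apply: ler_pM; rewrite ?nrm_ge0 // (le_trans hT).
have hPsi := dist _ (contractive_nrm (v - a) Psi1).
have hPhi : nrm (star (Phi (v - a)) ** x) <= 3 * d / 2.
  by apply: dist; rewrite nrm_star contractive_nrm.
apply: le_trans (nrmB _ _) _.
apply: le_trans (lerD hvx (le_trans (nrmB _ _) (lerD hPsi hPhi))) _.
rewrite /g in dg *; lra.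
Qed.

End JordanPairs.



(** * From contractivity to the star relation and to triple homomorphisms *)

Section ContractiveStar.
Variables (R : realType) (A B : cstarAlgType R) (Phi Psi : {linear A -> B}).
Hypothesis hJ : jordan_triple_multiplicative Phi Psi.
Hypothesis Phi1 : contractive Phi.
Hypothesis Psi1 : contractive Psi.

(** The identity is homogeneous of degree two under real scaling, so [a] may be shrunk to norm at
    most [1 / 2]. *)
Lemma jordan_star_annihilates (a : A) : star a = a ->
  (Psi a - star (Phi a)) ** Phi a = 0.
Proof.
move=> aa; pose c := (2 * (nrm a + 1))^-1.
have a1 : 0 < nrm a + 1 by rewrite ltr_wpDl ?nrm_ge0.
have c0 : 0 < c by rewrite invr_gt0 mulr_gt0.
have ca : star (c%:C%C *: a) = c%:C%C *: a by rewrite starZr aa.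
have cn : nrm (c%:C%C *: a) <= 2^-1.
  rewrite nrmZr ?(ltW c0) // mulrC ler_pdivrMr ?mulr_gt0 //.
  by rewrite mulrA mulVf // mul1r lerDl.
have := jordan_star_small hJ Phi1 Psi1 ca cn.
rewrite !linearZ /= starZr -scalerBr -ascaleAl -ascaleAr scalerA => /eqP.
rewrite scaler_eq0 -rmorphM /= => /orP[|/eqP //].
by rewrite -(rmorph0 (real_complex R)) (inj_eq (@complexI R)) mulf_eq0 gt_eqF.
Qed.

End ContractiveStar.

Section Implications.
Variables (R : realType) (A B : cstarAlgType R) (Phi Psi : {linear A -> B}).
Hypothesis hJ : jordan_triple_multiplicative Phi Psi.

Lemma contractive_star_herm (a : A) : contractive Phi -> contractive Psi ->
  star a = a -> Psi a = star (Phi a).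
Proof.
move=> h1 h2 aa; apply/eqP; rewrite -subr_eq0; apply/eqP.
set d := _ - _.
have dP : d ** Phi a = 0 by exact: jordan_star_annihilates.
have dQ : star (Psi a) ** d = 0.
  have := jordan_star_annihilates (jordan_triple_sym hJ) h2 h1 aa.
  move/(congr1 (@star _ _)); rewrite starM star0 starD starN starK.
  by rewrite -opprB -/d amulNr => /eqP; rewrite oppr_eq0 => /eqP.
(* In [star d = star (Psi a) - Phi a] the first term is killed by the right factor [d], the second
   by the left one. *)
have d3 : d ** (star d ** d) = 0.
  rewrite {2}/d starD starN starK amulDl amulDr dQ amulNl amulNr amulA dP.
  by rewrite amul0l amul0r subr0.
have dd : star d ** d = 0.
  apply: nrm_eq0; apply/eqP; rewrite -sqrf_eq0 -nrm_sqr ?starM ?starK //.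
  by rewrite -amulA d3 amul0r nrm0.
by apply: nrm_eq0; apply/eqP; rewrite -sqrf_eq0 -nrm_star_amul dd nrm0.
Qed.

Lemma contractive_star : contractive Phi /\ contractive Psi ->
  forall a : A, Psi a = star (Phi (star a)).
Proof.
move=> [h1 h2] a; pose p := a + star a; pose q := - 'i *: (a - star a).
have pp : star p = p by rewrite starD starK addrC.
have qq : star q = q.
  by rewrite starZ rmorphN /= conjCi opprK starD starN starK /q; module.
have i2 : 'i * 'i = -1 :> R[i] by rewrite -expr2 sqrCi.
have a2 : 2%:R *: a = p + 'i *: q.
  by rewrite /p /q scalerA mulrN i2 opprK scale1r; module.
have sa2 : 2%:R *: star a = p + - 'i *: q.
  by rewrite /p /q scalerA mulrNN i2; module.
move: p q pp qq a2 sa2 => p q pp qq a2 sa2.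
have : 2%:R *: Psi a = 2%:R *: star (Phi (star a)).
  have -> : 2%:R *: Psi a = Psi (2%:R *: a) by rewrite linearZ.
  rewrite a2 linearD linearZ /= !contractive_star_herm //.
  have -> : 2%:R *: star (Phi (star a)) = star (Phi (2%:R *: star a)).
    by rewrite linearZ starZ conjC_nat.
  by rewrite sa2 linearD linearZ /= starD starZ rmorphN /= conjCi opprK.
by apply: scalerI; rewrite pnatr_eq0.
Qed.

Lemma polarize_triple (T : {linear A -> B}) :
  (forall a b : A, T (a ** star b ** a) = T a ** star (T b) ** T a) ->
  triple_homomorphism T.
Proof.
move=> H a b c; rewrite /triple_product linearZ; congr (_ *: _).
have E (C : cstarAlgType R) (u v w : C) : u ** star v ** w + w ** star v ** u =
    (u + w) ** star v ** (u + w) - u ** star v ** u - w ** star v ** w.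
  by rewrite !(amulDl, amulDr); module.
by rewrite !E !linearB !H linearD.
Qed.

Lemma star_triple_homomorphism : (forall a : A, Psi a = star (Phi (star a))) ->
  triple_homomorphism Phi /\ triple_homomorphism Psi.
Proof.
move=> H; case: hJ => J1 J2; split; apply: polarize_triple => a b.
  by rewrite J1 H starK.
by rewrite J2 [Psi b]H starK.
Qed.

End Implications.

(** * Contractivity of triple homomorphisms *)

Section Completeness.
Variables (R : realType) (A : cstarAlgType R).

Lemma nrm_complete (u : nat -> A) :
  (forall e, 0 < e -> exists N, forall n, (N <= n)%N -> nrm (u N - u n) <= e) ->
  exists l, forall e, 0 < e -> exists N, forall n, (N <= n)%N -> nrm (l - u n) <= e.
Proof.
move=> H.
have cu : cvg (u @ \oo)%classic.
  apply: cauchy_cvg; apply/cauchy_exP => e e0.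
  have er : e = (complex.Re e)%:C%C by rewrite RRe_real // gtr0_real.
  have e'0 : 0 < complex.Re e by rewrite -ltcR -er.
  have [N hN] := H _ (divr_gt0 e'0 (ltr0n R 2)).
  exists (u N); exists N => // n /= Nn.
  rewrite -ball_normE /= nrmE er ltcR (le_lt_trans (hN _ Nn)) //.
  by rewrite ltr_pdivrMr // ltr_pMr // ltr1n.
exists (lim (u @ \oo)%classic) => e e0.
have e0' : 0 < e%:C%C :> R[i] by rewrite ltcR.
have /cvgrPdist_lt /(_ _ e0') [N _ hN] := cu.
by exists N => n Nn; have := hN n Nn; rewrite /= nrmE ltcR => /ltW.
Qed.

(** The iterates from [0] are the partial sums of the Neumann series of [a]; [dist] sums the
    geometric bounds of the steps. *)
Lemma affine_fixpoint (L : A -> A) (a : A) (r : R) : 0 <= r < 1 ->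
  (forall u v, L (u - v) = L u - L v) -> (forall u, nrm (L u) <= r * nrm u) ->
  exists f, f = a + L f.
Proof.
move=> /andP[r0 r1] LB Lr; pose u n := iter n (fun f => a + L f) 0.
have r'0 : 0 < 1 - r by rewrite subr_gt0.
have step n : nrm (u n.+1 - u n) <= r ^+ n * nrm a.
  elim: n => [|n IH].
    have L0 : L 0 = 0 by have := LB 0 0; rewrite !subrr.
    by rewrite /u /= L0 addr0 subr0 mul1r.
  have -> : u n.+2 - u n.+1 = L (u n.+1 - u n) by rewrite LB /u /=; module.
  by rewrite (le_trans (Lr _)) // exprS -mulrA ler_wpM2l.
have dist n k : nrm (u n - u (n + k)%N) <= r ^+ n * nrm a / (1 - r) * (1 - r ^+ k).
  elim: k => [|k IH]; first by rewrite addn0 subrr nrm0 expr0 subrr mulr0.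
  have -> : u n - u (n + k.+1)%N = (u n - u (n + k)%N) - (u (n + k).+1 - u (n + k)%N).
    by rewrite addnS; module.
  rewrite (le_trans (nrmB _ _)) // (le_trans (lerD IH (step _))) //.
  rewrite le_eqVlt; apply/orP; left; apply/eqP; rewrite exprD exprS.
  by field; rewrite gt_eqF.
have [l hl] : exists l, forall e, 0 < e -> exists N, forall n, (N <= n)%N ->
    nrm (l - u n) <= e.
  apply: nrm_complete => e e0.
  have a1 : 0 < nrm a + 1 by rewrite ltr_wpDl ?nrm_ge0.
  have r01 : 0 <= r < 1 by rewrite r0.
  have [N hN] := expr_small r01 (divr_gt0 (mulr_gt0 e0 r'0) a1).
  exists N => n Nn; rewrite -(subnKC Nn) (le_trans (dist _ _)) //.
  have rN : 0 <= r ^+ N by rewrite exprn_ge0.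
  apply: le_trans (_ : r ^+ N * nrm a / (1 - r) <= _).
    rewrite ler_piMr ?divr_ge0 ?mulr_ge0 ?nrm_ge0 ?(ltW r'0) //.
    by rewrite gerBl exprn_ge0.
  rewrite ler_pdivrMr //; apply: le_trans (_ : r ^+ N * (nrm a + 1) <= _).
    by rewrite ler_wpM2l // lerDl.
  by rewrite -ler_pdivlMr.
exists l; apply/eqP; rewrite -subr_eq0; apply/eqP/nrm_eq0/eqP.
rewrite eq_le nrm_ge0 andbT; apply: (@le_limit _ _ _ 2) => // e e0 e1.
have [N hN] := hl e e0.
have -> : l - (a + L l) = (l - u N.+1) - L (l - u N) by rewrite LB /u /=; module.
rewrite add0r (le_trans (nrmB _ _)) //.
have h1 := hN N.+1 (leqnSn N); have h2 := hN N (leqnn N).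
have := Lr (l - u N); have := nrm_ge0 (l - u N); nra.
Qed.

End Completeness.

Section TripleContractive.
Variables (R : realType) (B : cstarAlgType R).

Lemma normal_adj (h w : B) (p q r : {poly R}) : star h = h ->
  star (pact h p w + 'i *: pact h q w) ** pact h r (pact h p w + 'i *: pact h q w) =
  star w ** pact h ((p ^+ 2 + q ^+ 2) * r) w.
Proof.
move=> hh; rewrite starD starZi pactDr pactZrC amulDl !amulDr.
rewrite -!ascaleAl -!ascaleAr !pact_adj //.
rewrite -!pactM.
rewrite (_ : (p ^+ 2 + q ^+ 2) * r = p * r * p + q * r * q); last by ring.
rewrite (_ : q * r * p = p * r * q); last by ring.
rewrite pactD amulDr scalerA mulNr -expr2 sqrCi opprK scale1r; module.
Qed.

(** Product form of the sum of [X^(4 i)] over [i < 2^m]. *)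
Fixpoint geom4 (m : nat) : {poly R} :=
  if m is n.+1 then geom4 n * (1 + 'X^(2 ^ n.+1) ^+ 2) else 1.

(** Each factor [1 + x^2] is [n^* n] for the normal operator [n = 1 + i x]; [v] is the image of [w]
    under the product of these operators. *)
Lemma geom4_normal (h w : B) m : star h = h -> exists v,
  forall p, star v ** pact h p v = star w ** pact h (geom4 m * p) w.
Proof.
move=> hh; elim: m => [|m [v hv]]; first by exists w => p; rewrite mul1r.
exists (pact h 1 v + 'i *: pact h 'X^(2 ^ m.+1) v) => p.
by rewrite normal_adj // expr1n hv /= mulrA.
Qed.

(* The factor [2] comes from [1 + x^4 = 2 x^2 + (1 - x^2)^2], with [x] a power
   of ['X]. *)
Lemma geom4_lower (h w : B) m : star h = h -> nrm h = 1 ->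
  2 ^+ m * nrm (pact h 'X^(2 ^ m) w) ^+ 2 <= nrm (star w ** pact h (geom4 m) w).
Proof.
move=> hh h1; elim: m w => [|m IH] w.
  rewrite mul1r expn0 expr1 pactX pact1 nrm_star_amul.
  by rewrite ler_pXn2r ?nnegrE ?nrm_ge0 // (le_trans (nrmM _ _)) // h1 mul1r.
have [v hv] := geom4_normal w m hh.
set x : {poly R} := 'X^(2 ^ m); have x2 : 'X^(2 ^ m.+1) = x ^+ 2 by rewrite -exprM mulnC expnS.
have s2 : Num.sqrt 2 ^+ 2 = 2 :> R by rewrite sqr_sqrtr.
have := two_squares hh (Num.sqrt 2 *: x) (1 - x ^+ 2) v.
have -> : (Num.sqrt 2 *: x) ^+ 2 + (1 - x ^+ 2) ^+ 2 = 1 + (x ^+ 2) ^+ 2.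
  by rewrite exprZn s2 -mul_polyC polyC_natr; ring.
rewrite hv pactZ nrmZr ?sqrtr_ge0 // exprMn s2 [geom4 m.+1]/= x2.
apply: le_trans.
rewrite exprS -mulrA ler_pM2l // expr2 pactM.
rewrite (le_trans (IH _)) // -/x pact_adj // -!pactM.
rewrite -nrm_star_amul pact_adj // -pactM hv.
by rewrite (_ : geom4 m * (x * x) = x * geom4 m * x); last by ring.
Qed.

(** The exponent is one less than [2^m] because the argument [h] supplies the last factor. *)
Lemma pact_sqr_iter (h : B) m :
  iter m (fun v => v ** v) h = pact h 'X^((2 ^ m).-1) h.
Proof.
elim: m => [|m IH]; first by rewrite pact1.
rewrite iterS IH pactXM -pactM -exprSr -exprD; congr (pact h 'X^_ h).
by rewrite prednK ?expn_gt0 // expnS mul2n -addnn -!subn1 addnBA ?expn_gt0.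
Qed.

Lemma sqr_iter_act (h w : B) m :
  iter m (fun v => v ** v) h ** w = pact h 'X^(2 ^ m) w.
Proof. by rewrite pact_sqr_iter pactXM -exprSr prednK ?expn_gt0. Qed.

(* Such a [z] would bound the partial sums of the powers [h^(4 k + 1)]. *)
Lemma no_resolvent (h z : B) : star h = h -> nrm h = 1 ->
  z <> h + h ** h ** z ** (h ** h).
Proof.
move=> hh h1 hz; pose H m := iter m (fun v => v ** v) h.
have HH m : star (H m) = H m by rewrite /H pact_sqr_iter pact_herm.
have H1 m : nrm (H m) = 1.
  by elim: m => // m IH; rewrite /H iterS nrm_sqr ?HH // -/(H m) IH expr1n.
have HA m w : H m ** w = pact h 'X^(2 ^ m) w by exact: sqr_iter_act.
have hH m : h ** H m = pact h 'X^(2 ^ m) h.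
  by rewrite /H pact_sqr_iter -pact_mulX -pactMX -exprSr prednK ?expn_gt0.
(* Inserting the formula into itself squares the outer factors and doubles the number of powers in
   the sum. *)
have E m : z = pact h (geom4 m) h + H m.+1 ** z ** H m.+1.
  elim: m => [|m IH]; first by rewrite pact1.
  rewrite {1}IH {1}IH amulDr amulDl /= addrA; congr (_ + _).
    rewrite mulrDr mulr1 pactD; congr (_ + _).
    rewrite -[H m ** H m]/(H m.+1) HA pact_amul pact_amul hH -!pactM.
    by congr (pact h _ h); ring.
  by rewrite !amulA.
(* By [E] the partial sum has norm at most [2 |z|], while [geom4_lower] tested on [h] makes it at
   least [2^m]. *)
have up m : 2 ^+ m <= 2 * nrm z.
  have bX n : bnd h 'X^n 1.
    elim: n => [|n IH]; first exact: bnd1.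
    by rewrite exprS -[1]mulr1; apply: bndM => //; apply: bndX; rewrite h1.
  have low : 1 <= nrm (pact h 'X^(2 ^ m) h).
    rewrite -(H1 m.+1) /H iterS -/(H m) sqr_iter_act /H pact_sqr_iter pactCM.
    by apply: le_trans (bX _ _) _; rewrite mul1r.
  apply: le_trans (_ : 2 ^+ m * nrm (pact h 'X^(2 ^ m) h) ^+ 2 <= _).
    by rewrite ler_peMr ?exprn_ge0 // expr_ge1 // nrm_ge0.
  apply: le_trans (geom4_lower h m hh h1) _; rewrite hh.
  apply: le_trans (nrmM _ _) _; rewrite h1 mul1r.
  have -> : pact h (geom4 m) h = z - H m.+1 ** z ** H m.+1 by rewrite {1}(E m) addrK.
  have HzH : nrm (H m.+1 ** z ** H m.+1) <= nrm z.
    apply: le_trans (nrmM _ _) _; rewrite H1 mulr1.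
    by apply: le_trans (nrmM _ _) _; rewrite H1 mul1r.
  apply: le_trans (nrmB _ _) _; rewrite mulr_natl mulr2n lerD2l //.
have := archi_boundP (mulr_ge0 (ler0n R 2) (nrm_ge0 z)); set n := Num.bound _.
move=> /(le_lt_trans (up n)); rewrite -natrX ltr_nat ltnNge.
by rewrite ltnW // ltn_expl.
Qed.

Lemma triple_sandwich (A : cstarAlgType R) (T : {linear A -> B}) (a b : A) :
  triple_homomorphism T -> T (a ** star b ** a) = T a ** star (T b) ** T a.
Proof.
have E (C : cstarAlgType R) (u v : C) : triple_product u v u = u ** star v ** u.
  have half : 2^-1 + 2^-1 = 1 :> R[i] by field.
  by rewrite /triple_product scalerDr -scalerDl half scale1r.
by move=> /(_ a b a); rewrite !E.
Qed.

Lemma triple_norm1 (A : cstarAlgType R) (T : {linear A -> B}) (a : A) :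
  triple_homomorphism T -> nrm a < 1 -> nrm (T a) <> 1.
Proof.
move=> hT a1 Ta; pose Q u := a ** star u ** a.
have TQ u : T (Q u) = T a ** star (T u) ** T a by exact: triple_sandwich.
have QB u v : Q (u - v) = Q u - Q v.
  by rewrite /Q starD starN amulDr amulDl amulNr amulNl.
have Qn u : nrm (Q u) <= nrm a ^+ 2 * nrm u.
  rewrite (le_trans (nrmM _ _)) // expr2 mulrAC ler_wpM2r ?nrm_ge0 //.
  by rewrite (le_trans (nrmM _ _)) // nrm_star.
have a20 : 0 <= nrm a ^+ 2 by rewrite exprn_ge0 ?nrm_ge0.
have r1 : 0 <= (nrm a ^+ 2) ^+ 4 < 1.
  by rewrite exprn_ge0 // -exprM exprn_ilt1 ?nrm_ge0.
have Q4n u : nrm (Q (Q (Q (Q u)))) <= (nrm a ^+ 2) ^+ 4 * nrm u.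
  move: (nrm a ^+ 2) Qn a20 => r Qr r0.
  rewrite (_ : r ^+ 4 * nrm u = r * (r * (r * (r * nrm u)))); last by ring.
  by do 3 (apply: le_trans (Qr _) _; apply: ler_wpM2l => //); exact: Qr.
have Q4B u v : Q (Q (Q (Q (u - v)))) = Q (Q (Q (Q u))) - Q (Q (Q (Q v))).
  by rewrite !QB.
have [f hf] := affine_fixpoint a r1 Q4B Q4n.
set x := T a in Ta TQ.
have hf' : T f = x + T (Q (Q (Q (Q f)))) by rewrite {1}hf linearD.
have hh : star (x ** star x) = x ** star x by rewrite starM starK.
have h1 : nrm (x ** star x) = 1 by rewrite nrm_amul_star Ta expr1n.
(* On the image, [Q^4] acts as [u] goes to [h^2 u k^2] with [h = x x^*] and [k = x^* x]; multiplying
   by [x^*] on the right turns [k] into [h]. *)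
apply: (no_resolvent hh h1 (z := T f ** star x)).
by rewrite {1}hf' !TQ amulDl !(starM, starK, amulA).
Qed.

Lemma triple_contractive (A : cstarAlgType R) (T : {linear A -> B}) :
  triple_homomorphism T -> contractive T.
Proof.
move=> hT a; rewrite !nrmE lecR leNgt; apply/negP => lt.
have T0 : 0 < nrm (T a) := le_lt_trans (nrm_ge0 a) lt.
pose c := (nrm (T a))^-1; have c0 : 0 <= c by rewrite invr_ge0 ltW.
apply: (@triple_norm1 _ T (c%:C%C *: a) hT).
  by rewrite nrmZr // mulrC ltr_pdivrMr // mul1r.
by rewrite linearZ nrmZr // mulVf // gt_eqF.
Qed.

End TripleContractive.

Theorem theorem2p9 (R : realType) (A B : cstarAlgType R)
    (Phi Psi : {linear A -> B})
    (hJ : jordan_triple_multiplicative Phi Psi) :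
  [<-> contractive Phi /\ contractive Psi;
       forall a : A, Psi a = star (Phi (star a));
       triple_homomorphism Phi /\ triple_homomorphism Psi].
Proof.
tfae.
- exact: contractive_star.
- exact: star_triple_homomorphism.
- by move=> [hPhi hPsi]; split; exact: triple_contractive.
Qed.
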